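(* Let $(W,S)$ be an arbitrary Coxeter system (not assumed finite) with set of reflections $T$, and let $w, x \in W$. Let $[e,w]\,x^{-1} = \{\, vx^{-1} : v \le w \,\}$, partially ordered by the restriction of the Bruhat order of $W$. For every reflection ordering $\prec$ of $T$ having $N(x)$ as an initial section, the right labeling $\lambda_R(y\lessdot z) = y^{-1}z$ of the cover relations of $[e,w]\,x^{-1}$, with label set $(T,\prec)$, is an EL-labeling of $[e,w]\,x^{-1}$.
   Context: $(W,S)$ is a Coxeter system with identity $e$, length function $\ell$, reflections $T=\bigcup_{w\in W} wSw^{-1}$, and Bruhat order $\le$. The left inversion set of $x\in W$ is $N(x)=\{t\in T:\ell(tx)<\ell(x)\}$. Reflection orderings: a reflection subgroup is a subgroup $W'\subseteq W$ generated by a subset of $T$; it is a Coxeter group with canonical generating set $\chi(W')=\{t\in T: N(t)\cap W'=\{t\}\}$, and it is dihedral if $|\chi(W')|=2$. A total order $\prec$ on $T$ is a reflection ordering if, for every dihedral reflection subgroup $W'$ with $\chi(W')=\{r,t\}$, its restriction to the reflections in $W'$ is $r\prec rtr\prec rtrtr\prec\cdots\prec trt\prec t$ or the reverse of this order. An initial section of $\prec$ is a set of the form $\{t\in T: t\prec t_0\}$ for some $t_0\in T$, or $\emptyset$, or $T$. EL-labeling: let $P$ be a finite graded poset with minimum and maximum, and let $\lambda$ be a map from the cover relations of $P$ to a totally ordered set $(\Lambda,\prec)$. A maximal chain $p=c_0\lessdot\cdots\lessdot c_k=q$ of an interval $[p,q]$ is increasing if $\lambda(c_0\lessdot c_1)\prec\cdots\prec\lambda(c_{k-1}\lessdot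 c_k)$; maximal chains of $[p,q]$ are compared in the lexicographic order on their label sequences. The map $\lambda$ is an EL-labeling if every interval $[p,q]$ of $P$ has a unique increasing maximal chain, and this chain is lexicographically first among the maximal chains of $[p,q]$. (Part of the assertion is that $[e,w]\,x^{-1}$ is a finite graded poset with minimum and maximum and that the labels $y^{-1}z$ of its covers lie in $T$.) *)

(* Defs.v *)
From mathcomp Require Import all_boot.
From mathcomp Require Import boolp classical_sets cardinality.
From Stdlib Require Import Relation_Operators.

Set Implicit Arguments.
Unset Strict Implicit.
Unset Printing Implicit Defensive.

Local Open Scope classical_set_scope.
Local Open Scope group_scope.

Definition is_subgroup (W : groupType) (H : set W) : Prop :=
  [/\ H 1, (forall x y, H x -> H y -> H (x * y))
    & (forall x, H x -> H x^-1)].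

Definition generated (W : groupType) (A : set W) : set W :=
  smallest (@is_subgroup W) A.

(* The value 0 encodes m(s,t) = oo. *)
Definition coxeter_matrix (W : Type) (S : set W) (m : W -> W -> nat) : Prop :=
  [/\ forall s, S s -> m s s = 1%N,
      forall s t, S s -> S t -> m s t = m t s
    & forall s t, S s -> S t -> s <> t -> m s t <> 1%N].

(* With the above encoding, the relation (st)^m(s,t) = 1 is void for
   m(s,t) = oo. *)
Definition coxeter_relations (W : Type) (S : set W) (m : W -> W -> nat)
    (G : groupType) (f : W -> G) : Prop :=
  forall s t, S s -> S t -> (f s * f t) ^+ m s t = 1.

(* W is presented by < S | (st)^m(s,t) = 1 >: it is generated by S, satisfies
   the relations, and is universal with these properties. *)
Definition coxeter_presentation (W : groupType) (S : set W)
    (m : W -> W -> nat) : Prop :=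
  [/\ generated S = setT,
      coxeter_relations S m (fun s : W => s)
    & forall (G : groupType) (f : W -> G), coxeter_relations S m f ->
        exists2 phi : W -> G, {morph phi : x y / x * y >-> x * y}
                            & forall s, S s -> phi s = f s].

Definition coxeter_system (W : groupType) (S : set W) : Prop :=
  exists2 m, coxeter_matrix S m & coxeter_presentation S m.

Definition has_word (W : groupType) (S : set W) (w : W) (n : nat) : Prop :=
  exists s : seq W,
    [/\ size s = n, forall a, a \in s -> S a & \prod_(a <- s) a = w].

(* The minimum exists for every w as soon as S generates W and consists of
   involutions. *)
Definition len (W : groupType) (S : set W) (w : W) : nat :=
  get [set n | has_word S w n /\ forall k, has_word S w k -> (n <= k)%N].

Definition reflections (W : groupType) (S : set W) : set W :=
  [set t | exists w, exists2 s, S s & t = w * s * w^-1].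

Definition bruhat (W : groupType) (S : set W) : W -> W -> Prop :=
  clos_refl_trans W (fun u v =>
    (exists2 t, reflections S t & v = u * t) /\ (len S u < len S v)%N).

Definition left_inversions (W : groupType) (S : set W) (x : W) : set W :=
  [set t | reflections S t /\ (len S (t * x) < len S x)%N].

Definition reflection_subgroup (W : groupType) (S H : set W) : Prop :=
  exists2 A, A `<=` reflections S & H = generated A.

Definition canonical_generators (W : groupType) (S H : set W) : set W :=
  [set t | reflections S t /\ left_inversions S t `&` H = [set t]].

Definition strict_total_order_on (L : Type) (A : set L)
    (lt : L -> L -> Prop) : Prop :=
  [/\ forall a, A a -> ~ lt a a,
      forall a b c, A a -> A b -> A c -> lt a b -> lt b c -> lt a c
    & forall a b, A a -> A b -> [\/ lt a b, a = b | lt b a]].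

Definition has_order (W : groupType) (g : W) (m : nat) : Prop :=
  [/\ (0 < m)%N, g ^+ m = 1 & forall k, (0 < k < m)%N -> g ^+ k <> 1].

(* The reflections r, rtr, rtrtr, ... for k = 0, 1, 2, ... *)
Definition alternating (W : groupType) (r t : W) (k : nat) : W :=
  (r * t) ^+ k * r.

(* r < rtr < rtrtr < ... < trt < t.  If rt has finite order m, these are the m
   reflections [alternating r t k] with k < m, the last one being t.  If rt has
   infinite order, the order type is omega + omega^*: first
   r < rtr < rtrtr < ..., then ... < trtrt < trt < t. *)
Definition dihedral_sorted (W : groupType) (lt : W -> W -> Prop)
    (r t : W) : Prop :=
  (forall m, has_order (r * t) m ->
     forall i j, (i < j < m)%N -> lt (alternating r t i) (alternating r t j))
  /\
  ((forall m, ~ has_order (r * t) m) ->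
     [/\ forall i j, (i < j)%N -> lt (alternating r t i) (alternating r t j),
         forall i j, lt (alternating r t i) (alternating t r j)
       & forall i j, (i < j)%N ->
           lt (alternating t r j) (alternating t r i)]).

Definition reflection_ordering (W : groupType) (S : set W)
    (lt : W -> W -> Prop) : Prop :=
  strict_total_order_on (reflections S) lt /\
  forall (H : set W) (r t : W), reflection_subgroup S H -> r <> t ->
    canonical_generators S H = [set r; t] ->
    dihedral_sorted lt r t \/ dihedral_sorted (fun a b => lt b a) r t.

Definition initial_section (L : Type) (A : set L) (lt : L -> L -> Prop)
    (I : set L) : Prop :=
  [\/ I = set0, I = A | exists2 a0, A a0 & I = [set a | A a /\ lt a a0]].

(* Posets are subsets P of a type X, with the relation le restricted to P. *)

Definition partial_order_on (X : Type) (P : set X) (le : X -> X -> Prop) :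
    Prop :=
  [/\ forall x, P x -> le x x,
      forall x y, P x -> P y -> le x y -> le y x -> x = y
    & forall x y z, P x -> P y -> P z -> le x y -> le y z -> le x z].

Definition covers (X : Type) (P : set X) (le : X -> X -> Prop) (y z : X) :
    Prop :=
  [/\ P y, P z, le y z, y <> z
    & forall u, P u -> le y u -> le u z -> u = y \/ u = z].

(* The chain c_0 = p, c_1, ..., c_k = q is given by p, c = [:: c_1; ...; c_k]
   and q. *)
Definition maximal_chain (X : Type) (P : set X) (le : X -> X -> Prop)
    (p : X) (c : seq X) (q : X) : Prop :=
  path (fun y z => `[< covers P le y z >]) p c /\ last p c = q.

Definition finite_graded_bounded_poset (X : Type) (P : set X)
    (le : X -> X -> Prop) : Prop :=
  [/\ finite_set P, partial_order_on P le
    & exists bot top,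
      [/\ P bot, P top, forall x, P x -> le bot x /\ le x top
        & forall c c', maximal_chain P le bot c top ->
            maximal_chain P le bot c' top -> size c = size c']].

Fixpoint lex_lt (L : Type) (lt : L -> L -> Prop) (s1 s2 : seq L) : Prop :=
  match s1, s2 with
  | a :: s1', b :: s2' => lt a b \/ (a = b /\ lex_lt lt s1' s2')
  | [::], _ :: _ => True
  | _, [::] => False
  end.

Definition increasing (L : Type) (lt : L -> L -> Prop) (s : seq L) : Prop :=
  sorted (fun a b => `[< lt a b >]) s.

Definition EL_labeling (X L : Type) (P : set X) (le : X -> X -> Prop)
    (A : set L) (lt : L -> L -> Prop) (lam : X -> X -> L) : Prop :=
  [/\ finite_graded_bounded_poset P le,
      strict_total_order_on A lt,
      forall y z, covers P le y z -> A (lam y z)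
    & forall p q, P p -> P q -> le p q ->
        exists c,
          [/\ maximal_chain P le p c q,
              increasing lt (pairmap lam p c),
              forall c', maximal_chain P le p c' q ->
                increasing lt (pairmap lam p c') -> c' = c
            & forall c', maximal_chain P le p c' q -> c' <> c ->
                lex_lt lt (pairmap lam p c) (pairmap lam p c')]].

Definition twisted_lower_interval (W : groupType) (S : set W) (w x : W) :
    set W :=
  [set v * x^-1 | v in [set v | bruhat S v w]].

Definition right_label (W : groupType) (y z : W) : W := y^-1 * z.

(* Main.v *)
From Stdlib Require Import Relation_Operators ZArith Lia.
Require Import Defs.
From HB Require Import structures.
From mathcomp Require Import all_boot.
From mathcomp Require Import boolp classical_sets cardinality.
From mathcomp Require Import zify.

(** Why the theorem holds.

   Write N(x) for the set of left inversions of x.  It satisfies the cocycle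
   rule N(xy) = N(x) + x N(y) x^-1, where + is symmetric difference.  Hence, if
   t is a reflection with c < ct, then ctx < cx when t is in N(x) and ctx > cx
   otherwise.  Along a chain c_0, ..., c_k whose labels increase for an ordering
   with initial section N(x), the labels in N(x) come first; so the elements
   c_i x first go down and then up, and all of them lie below w as soon as
   c_0 x and c_k x do.  Therefore an increasing saturated chain of W between two
   elements of [e,w] x^-1 stays inside this set ([inc_chain_stays]).  This shows
   that covers of [e,w] x^-1 are covers of W, and it reduces the theorem to
   Dyer's theorem for W: for every reflection ordering, each Bruhat interval
   [u,v] has exactly one increasing saturated chain ([inc_chain_unique]), and
   this chain is lexicographically first ([inc_chain_lex]).

   Existence and uniqueness are proved together, by induction on the length of
   v and for all reflection orderings at once.  Let s be a right descent of v.
   The reflections below s, and those above s, are stable under conjugation by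
   s, and moving s to the last place while conjugating the part above s gives a
   new reflection ordering ([conj_ordering]).
   - If us > u, then an increasing chain from u to v has exactly one label s;
     deleting it and conjugating what follows is a bijection onto the chains
     from u to vs that increase for the new ordering ([ascent_unique]).
   - If us < u, put u' = us and consider all pairs of a decreasing chain from u'
     to z and an increasing chain from z to v.  Moving the smallest label at z
     from one chain to the other is an involution that changes the parity of the
     length of z.  Multiplication by s is an involution with the same property on
     the set of all z.  Every z carries exactly one pair, except possibly z = u,
     so the two counts agree only if u carries exactly one pair as well
     ([toggle_count], [descent_unique]).

   For the lexicographic statement, an atom of [u,v] whose label is minimal but
   which is not on the increasing chain leads to an interval of length two in
   which both chains are present with labels q < r < a < b and ab = rq.  An
   induction on left descents, which preserve labels, shows that the four labels
   lie in one dihedral reflection subgroup ([diamond_dihedral]); there the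
   alternating order of the reflections excludes this configuration
   ([diamond_order]).

   The dihedral subgroups needed are those generated by two reflections; their
   canonical generators are found in [dihedral_structure].  The cocycle N itself
   comes from the universal property of the Coxeter presentation, applied to a
   semidirect product of sets of reflections with W ([inv_cocycle_spec]). *)

Set Implicit Arguments.
Unset Strict Implicit.
Unset Printing Implicit Defensive.

Local Open Scope classical_set_scope.
Local Open Scope group_scope.

(** * A semidirect product carrying cocycles *)

(** Pairs of a subset of [W], given by its characteristic function, and an element
   of [W]: the semidirect product for symmetric difference and the conjugation
   action. A homomorphism [w |-> (N w, w)] into it is exactly a cocycle [N]. *)
Definition flip_group (W : Type) : Type := ((W -> bool) * W)%type.

Section FlipGroup.
Variable W : groupType.

HB.instance Definition _ := Choice.on (flip_group W).

Definition flip_mul (x y : flip_group W) : flip_group W :=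
  (fun p => x.1 p (+) y.1 (p ^ x.2), x.2 * y.2).
Definition flip_one : flip_group W := (fun=> false, 1).
Definition flip_inv (x : flip_group W) : flip_group W :=
  (fun p => x.1 (p ^ x.2^-1), x.2^-1).

Lemma flip_mulA : associative flip_mul.
Proof.
move=> x y z; congr pair; last exact: mulgA.
by apply/funext => p /=; rewrite conjgM addbA.
Qed.

Lemma flip_mul1 : left_id flip_one flip_mul.
Proof.
move=> [A w]; congr pair; last exact: mul1g.
by apply/funext => p /=; rewrite conjg1.
Qed.

Lemma flip_mulr1 : right_id flip_one flip_mul.
Proof.
move=> [A w]; congr pair; last exact: mulg1.
by apply/funext => p /=; rewrite addbF.
Qed.

Lemma flip_mulV : left_inverse flip_one flip_inv flip_mul.
Proof.
move=> [A w]; congr pair; last exact: mulVg.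
by apply/funext => p /=; rewrite addbb.
Qed.

Lemma flip_mulrV : right_inverse flip_one flip_inv flip_mul.
Proof.
move=> [A w]; congr pair; last exact: mulgV.
by apply/funext => p /=; rewrite -conjgM mulgV conjg1 addbb.
Qed.

HB.instance Definition _ := isGroup.Build (flip_group W)
  flip_mulA flip_mul1 flip_mulr1 flip_mulV flip_mulrV.

End FlipGroup.

Lemma conj_by_self (W : groupType) (s : W) : s ^ s = s.
Proof. by rewrite conjgE mulKg. Qed.

Lemma eq_conjg (W : groupType) (x y z : W) : (x ^ z == y) = (x == y ^ z^-1).
Proof. by apply/eqP/eqP => [<-|->]; rewrite ?conjgK ?conjgKV. Qed.

(** Conjugation by [s] inverts the rotation [s * t]. *)
Lemma dihedral_swap (W : groupType) (s t : W) n : s * s = 1 -> t * t = 1 ->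
  s * (s * t) ^- n = (s * t) ^+ n * s.
Proof.
move=> ss tt; have sV := mulg1_eq ss; have tV := mulg1_eq tt.
have: (s * t) ^+ n = (s * t) ^- n ^ s.
  rewrite -expVgn conjXg invgM sV tV; congr (_ ^+ n).
  by rewrite conjgE sV -mulgA ss mulg1.
by rewrite conjgE sV => {2}->; rewrite -!mulgA ss mulg1.
Qed.

(** * A counting principle *)

Lemma lift_seq (A : eqType) (X : eqType) (Q : X -> Prop) (en : X -> A) (l : seq A) :
  {in l, forall z, exists2 x, Q x & en x = z} ->
  exists2 xs, map en xs = l & {in xs, forall x, Q x}.
Proof.
elim: l => [|z l IH] h; first by exists [::].
have [xs xsl Qxs] : exists2 xs, map en xs = l & {in xs, forall x, Q x}.
  by apply: IH => y yl; apply: h; rewrite inE yl orbT.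
have [x Qx xz] := h z (mem_head _ _).
exists (x :: xs); first by rewrite /= xz xsl.
by move=> y; rewrite inE => /orP[/eqP->|/Qxs].
Qed.

(** If [u] had no element in its fibre, [tog] would embed the fibres over [E] into
   those over [O] without [u]; if it had two, [tog] would embed the fibres over
   [O], now one more than [size O], into those over [E]. *)
Lemma toggle_count (A X : eqType) (E O : seq A) (u : A) (P : X -> Prop)
    (en : X -> A) (tog : X -> X) :
  uniq E -> uniq O -> size E = size O -> u \in O ->
  {in E, forall z, exists! x, P x /\ en x = z} ->
  {in O, forall z, z != u -> exists! x, P x /\ en x = z} ->
  (forall x, P x -> P (tog x)) -> (forall x, P x -> tog (tog x) = x) ->
  (forall x, P x -> en x \in E -> en (tog x) \in O) ->
  (forall x, P x -> en x \in O -> en (tog x) \in E) ->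
  exists! x, P x /\ en x = u.
Proof.
move=> uE uO EO uinO PE PO Ptog togK togE togO.
have fiber z x y : (exists! x, P x /\ en x = z) -> P x -> P y -> en x = z -> en y = z -> x = y.
  by move=> [w [_ h]] Px Py xz yz; rewrite -(h x)// -(h y).
have O0 : (0 < size O)%N by case: (O) uinO.
have tog_inj (l : seq X) : {in l, forall x, P x} ->
    {in l, forall x, exists! y, P y /\ en y = en (tog x)} ->
    {in l &, injective (en \o tog)}.
  move=> Pl fl x y xl yl /= e.
  suff e' : tog x = tog y by rewrite -(togK x (Pl x xl)) e' togK//; exact: Pl.
  by apply: (fiber (en (tog x))) => //; [exact: fl|exact/Ptog/Pl|exact/Ptog/Pl].
have [[x0 [Px0 x0u]]|no] := pselect (exists x, P x /\ en x = u); last first.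
  have [|xs xsE Pxs] := @lift_seq A X P en E.
    by move=> z /PE[x [[]]]; exists x.
  have nu x : P x -> en x != u by move=> Px; apply/eqP => xu; apply: no; exists x.
  have inO x : x \in xs -> en (tog x) \in O.
    by move=> xl; apply: togE; [exact: Pxs|rewrite -xsE; exact: map_f].
  have : (size (map (en \o tog) xs) <= size (rem u O))%N.
    apply: uniq_leq_size.
      rewrite map_inj_in_uniq; first by apply: (@map_uniq _ _ en); rewrite xsE.
      apply: tog_inj => // x xl; apply: PO; first exact: inO.
      exact/nu/Ptog/Pxs.
    move=> _ /mapP[x xl ->]; rewrite mem_rem_uniq// inE inO// andbT.
    exact/nu/Ptog/Pxs.
  rewrite size_map size_rem// -(size_map en) xsE EO; lia.
exists x0; split=> // x1 [Px1 x1u]; apply: contrapT => x01.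
have [|xs xsO Pxs] := @lift_seq A X P en (rem u O).
  move=> z; rewrite mem_rem_uniq// inE => /andP[zu /PO/(_ zu)[x [[]]]].
  by exists x.
have nin x : en x = u -> x \notin xs.
  move=> xu; apply/negP => xl; have : en x \in rem u O by rewrite -xsO map_f.
  by rewrite xu mem_rem_uniq// inE eqxx.
pose zs := [:: x0, x1 & xs].
have Pzs : {in zs, forall x, P x}.
  by move=> x; rewrite !inE => /or3P[/eqP->|/eqP->|/Pxs].
have inE' x : x \in zs -> en (tog x) \in E.
  move=> xl; apply: togO; first exact: Pzs.
  move: xl; rewrite !inE => /or3P[/eqP->|/eqP->|xl]; rewrite ?x0u ?x1u//.
  have : en x \in rem u O by rewrite -xsO map_f.
  exact: mem_rem.
have : (size (map (en \o tog) zs) <= size E)%N.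
  apply: uniq_leq_size; last by move=> _ /mapP[x xl ->]; exact: inE'.
  rewrite map_inj_in_uniq; last by apply: tog_inj => // x xl; apply: PE; exact: inE'.
  rewrite /zs /= !inE !negb_or !nin// !andbT andTb; apply/andP; split; first exact/eqP.
  by apply: (@map_uniq _ _ en); rewrite xsO rem_uniq.
rewrite size_map /= -(size_map en) xsO size_rem// EO; lia.
Qed.

(** * Integer powers *)

Section IntegerPowers.
Variable W : groupType.
Implicit Types (x y : W) (i j : Z).

Definition zexp x i : W :=
  if (0 <=? i)%Z then x ^+ Z.to_nat i else x ^- Z.to_nat (- i).

Lemma zexp_nat x n : zexp x (Z.of_nat n) = x ^+ n.
Proof. by rewrite /zexp Nat2Z.id; case: Z.leb_spec => //; lia. Qed.

Lemma zexpS x i : zexp x (i + 1) = zexp x i * x.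
Proof.
rewrite /zexp; case: Z.leb_spec => h1; case: Z.leb_spec => h2; try lia.
- by rewrite -expgSr; congr (x ^+ _); lia.
- have -> : i = (-1)%Z by lia.
  by rewrite /= mulVg.
- have -> : Z.to_nat (- i) = (Z.to_nat (- (i + 1))).+1 by lia.
  by rewrite expgS invgM mulgVK.
Qed.

Lemma zexpD x i j : zexp x (i + j) = zexp x i * zexp x j.
Proof.
elim/Z.peano_ind: j => [|j IH|j IH]; first by rewrite Z.add_0_r mulg1.
  by rewrite -Z.add_1_r Z.add_assoc !zexpS IH mulgA.
apply: (@mulIg _ x); rewrite -mulgA -!zexpS.
have -> : (i + Z.pred j + 1 = i + j)%Z by lia.
by have -> : (Z.pred j + 1 = j)%Z by lia.
Qed.

Lemma zexpN x i : zexp x (- i) = (zexp x i)^-1.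
Proof.
apply: (@mulIg _ (zexp x i)).
by rewrite mulVg -zexpD (_ : (- i + i = 0)%Z)//; lia.
Qed.

Lemma zexpV x i : zexp x^-1 i = zexp x (- i).
Proof.
elim/Z.peano_ind: i => [|i IH|i IH] //.
  by rewrite -Z.add_1_r zexpS IH Z.opp_add_distr zexpD.
apply: (@mulIg _ x^-1); rewrite -zexpS (_ : (Z.pred i + 1 = i)%Z); last lia.
by rewrite IH (_ : (- Z.pred i = - i + 1)%Z) ?zexpS ?mulgK//; lia.
Qed.

Lemma zexpJ x y i : zexp (x ^ y) i = zexp x i ^ y.
Proof. by rewrite /zexp; case: ifP; rewrite ?conjVg conjXg. Qed.

Lemma zexp_mul1 x i j : zexp x i = 1 -> zexp x (i * j) = 1.
Proof.
move=> xi; elim/Z.peano_ind: j => [|j IH|j IH]; first by rewrite Z.mul_0_r.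
  by rewrite Z.mul_succ_r zexpD IH xi mulg1.
by rewrite Z.mul_pred_r zexpD zexpN IH xi invg1 mulg1.
Qed.

(** As in the Coxeter matrix, the value 0 stands for infinite order; with this
   convention divisibility covers both cases. *)
Definition ord x (m : nat) : Prop := forall i, zexp x i = 1 <-> (Z.of_nat m | i)%Z.

Lemma ord_has_order x m : has_order x m -> ord x m.
Proof.
move=> [m0 xm mmin] i; split=> [xi|[k ->]]; last first.
  by rewrite Z.mul_comm zexp_mul1// zexp_nat.
apply/Z.mod_divide; first lia.
have r := Z.mod_pos_bound i (Z.of_nat m) ltac:(lia).
have xr : zexp x (i mod Z.of_nat m) = 1.
  rewrite Zmod_eq_full; last lia.
  by rewrite zexpD zexpN xi Z.mul_comm zexp_mul1 ?zexp_nat// invg1 mulg1.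
apply: contrapT => r0; apply: (mmin (Z.to_nat (i mod Z.of_nat m))); first lia.
by rewrite -zexp_nat Z2Nat.id ?xr//; lia.
Qed.

Lemma ord_infinite x : (forall m, ~ has_order x m) -> ord x 0.
Proof.
move=> no i; split=> [xi|]; last by move=> [k ->]; rewrite Z.mul_0_r.
case: (Z.eq_dec i 0) => [->|i0]; first by exists 0%Z.
have xa : x ^+ Z.abs_nat i == 1.
  rewrite -zexp_nat Zabs2Nat.id_abs; case: (Z.abs_eq_or_opp i) => ->.
    by rewrite xi.
  by rewrite zexpN xi invg1.
have ex : exists n, (0 < n)%N && (x ^+ n == 1).
  by exists (Z.abs_nat i); rewrite xa andbT; lia.
case: (ex_minnP ex) => m /andP[m0 /eqP xm] mmin.
case: (no m); split=> // k /andP[k0 km] xk.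
by have := mmin k; rewrite k0 xk eqxx => /(_ isT); lia.
Qed.

Lemma ord_exists x : exists m, ord x m.
Proof.
have [[m /ord_has_order]|no] := pselect (exists m, has_order x m); first by exists m.
by exists 0%N; apply: ord_infinite => m xm; apply: no; exists m.
Qed.

Lemma has_order_ord x m : (0 < m)%N -> ord x m -> has_order x m.
Proof.
move=> m0 xm; split=> //.
  by rewrite -zexp_nat; apply/xm; exact: Z.divide_refl.
move=> k km; rewrite -zexp_nat => /xm /Z.divide_pos_le; lia.
Qed.

Lemma ord_unique x m n : ord x m -> ord x n -> m = n.
Proof.
move=> xm xn; suff : Z.of_nat m = Z.of_nat n by lia.
apply: Z.divide_antisym_nonneg; [lia|lia| |].
  by apply/xm/xn/Z.divide_refl.
by apply/xn/xm/Z.divide_refl.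
Qed.

End IntegerPowers.

(** * Sequences of reflections in dihedral groups *)

Section Alternating.
Variable W : groupType.
Implicit Types r t x : W.

(** The two-sided sequence ..., trt, t, r, rtr, rtrtr, ..., with [r] at 0 and [t]
   at -1; for a rotation of order m it is periodic of period m. *)
Definition zalt r t (i : Z) : W := zexp (r * t) i * r.

Lemma zalt_conj r t x i : zalt (r ^ x) (t ^ x) i = zalt r t i ^ x.
Proof. by rewrite /zalt conjMg -zexpJ conjMg. Qed.

Lemma zalt0 r t : zalt r t 0 = r. Proof. exact: mul1g. Qed.

Lemma zalt_periodic r t m i j : ord (r * t) m -> zalt r t (i + Z.of_nat m * j) = zalt r t i.
Proof. by move=> o; rewrite /zalt zexpD zexp_mul1 ?mulg1//; apply/o/Z.divide_refl. Qed.

Section Involutions.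
Variables r t : W.
Hypotheses (rr : r * r = 1) (tt : t * t = 1).

Let rV : r^-1 = r := mulg1_eq rr.
Let tV : t^-1 = t := mulg1_eq tt.

Lemma rot_swap i : r * zexp (r * t) i = zexp (r * t) (- i) * r.
Proof.
apply: (@mulIg _ r); rewrite -[RHS]mulgA rr mulg1.
have -> : r * zexp (r * t) i * r = zexp (r * t) i ^ r by rewrite conjgE rV mulgA.
rewrite -zexpJ (_ : (r * t) ^ r = (r * t)^-1) ?zexpV//.
by rewrite invgM rV tV conjgE -!mulgA mulKg.
Qed.

Lemma zalt_mul i j : zalt r t i * zalt r t j = zexp (r * t) (i - j).
Proof.
rewrite /zalt -mulgA (mulgA r) rot_swap -mulgA rr mulg1 -zexpD.
by congr zexp; lia.
Qed.

Lemma zalt_sq i : zalt r t i * zalt r t i = 1.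
Proof. by rewrite zalt_mul Z.sub_diag. Qed.

Lemma zexp_zalt i j : zexp (r * t) i * zalt r t j = zalt r t (i + j).
Proof. by rewrite /zalt zexpD mulgA. Qed.

Lemma zalt_zexp i j : zalt r t i * zexp (r * t) j = zalt r t (i - j).
Proof. by rewrite /zalt -mulgA rot_swap mulgA -zexpD. Qed.

Lemma zalt_conj_zexp i k : zalt r t i ^ zexp (r * t) k = zalt r t (i - 2 * k).
Proof.
rewrite conjgE -zexpN zalt_zexp zexp_zalt; congr zalt; lia.
Qed.

Lemma zalt_conj_zalt i j : zalt r t i ^ zalt r t j = zalt r t (2 * j - i).
Proof.
rewrite conjgE (mulg1_eq (zalt_sq j)) zalt_mul zalt_zexp; congr zalt; lia.
Qed.

Lemma zalt_eq i j m : ord (r * t) m ->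
  zalt r t i = zalt r t j <-> (Z.of_nat m | i - j)%Z.
Proof.
move=> o; rewrite -(o (i - j)%Z) -zalt_mul; split=> [->|]; first exact: zalt_sq.
by move=> /mulg1_eq <-; rewrite (mulg1_eq (zalt_sq i)).
Qed.

Lemma zaltm1 : zalt r t (-1) = t.
Proof. by rewrite /zalt (zexpN _ 1) /= invgM rV tV -mulgA rr mulg1. Qed.

Lemma zalt_sym i : zalt t r i = zalt r t (- 1 - i).
Proof.
have e : t * r = (r * t)^-1 by rewrite invgM rV tV.
by rewrite /zalt e zexpV -{2}zaltm1 zexp_zalt; congr zalt; lia.
Qed.

Lemma alternatingE k : alternating r t k = zalt r t (Z.of_nat k).
Proof. by rewrite /zalt zexp_nat. Qed.

End Involutions.

Lemma ord_sym r t m : r * r = 1 -> t * t = 1 -> ord (r * t) m -> ord (t * r) m.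
Proof.
move=> rr tt o i; have e : t * r = (r * t)^-1.
  by rewrite invgM (mulg1_eq rr) (mulg1_eq tt).
by rewrite e zexpV o Z.divide_opp_r.
Qed.

Lemma ord_conj r t x m : ord (r * t) m -> ord (r ^ x * t ^ x) m.
Proof.
move=> o i; rewrite -conjMg zexpJ -o; split=> [/eqP|->]; last exact: conj1g.
by rewrite conjg_eq1 => /eqP.
Qed.

(** The order type prescribed for the indices of the two-sided sequence: the
   interval from 0 to [m] - 1 for finite order [m], and the nonnegative integers
   followed by the negative ones for infinite order. *)
Definition before (m : nat) (i j : Z) : Prop :=
  if m == 0%N then [\/ 0 <= i < j, i < j < 0 | 0 <= i /\ j < 0]%Z
  else (0 <= i < j /\ j < Z.of_nat m)%Z.

Lemma dihedral_sortedP r t m lt : r * r = 1 -> t * t = 1 -> ord (r * t) m ->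
  dihedral_sorted lt r t <-> forall i j, before m i j -> lt (zalt r t i) (zalt r t j).
Proof.
move=> rr tt o.
have tr k : alternating t r k = zalt r t (-1 - Z.of_nat k).
  by rewrite alternatingE zalt_sym.
(* [-1 - k] is the exponent of [alternating t r] giving the negative index [k] *)
have negK k : (k < 0 -> -1 - Z.of_nat (Z.to_nat (-1 - k)) = k)%Z by lia.
rewrite /before /dihedral_sorted; case: eqP => [m0|/eqP m0].
  have no n : ~ has_order (r * t) n.
    move=> h; have := ord_unique o (ord_has_order h); case: h => n0 _ _; lia.
  split=> [[_ /(_ no)[h1 h2 h3]] i j [] [ij ji]|h].
  - have := h1 (Z.to_nat i) (Z.to_nat j); rewrite !alternatingE !Z2Nat.id; [apply|..]; lia.
  - have := h3 (Z.to_nat (-1 - j)) (Z.to_nat (-1 - i)); rewrite !tr.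
    by rewrite !negK; [apply|..]; lia.
  - have := h2 (Z.to_nat i) (Z.to_nat (-1 - j)); rewrite tr alternatingE.
    by rewrite negK ?Z2Nat.id; [apply|..]; lia.
  split=> [n /no//|_]; split=> i j; rewrite ?tr ?alternatingE; [move=> ij| |move=> ij]; apply: h.
  - by apply: Or31; lia.
  - by apply: Or33; lia.
  - by apply: Or32; lia.
have mo := has_order_ord (ltac:(lia) : (0 < m)%N) o.
split=> [[/(_ _ mo) h _] i j ij|h].
  have := h (Z.to_nat i) (Z.to_nat j); rewrite !alternatingE !Z2Nat.id; [apply|..]; lia.
split=> [n nh|no]; last by case: (no m).
have <- := ord_unique o (ord_has_order nh).
by move=> i j ij; rewrite !alternatingE; apply: h; lia.
Qed.

(** Reflecting the index, [i |-> -1 - i], exchanges the two generators. *)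
Lemma dihedral_sorted_sym r t lt : r * r = 1 -> t * t = 1 ->
  dihedral_sorted (fun a b => lt b a) r t <-> dihedral_sorted lt t r.
Proof.
move=> rr tt; have [m o] := ord_exists (r * t).
rewrite (dihedral_sortedP _ rr tt o) (dihedral_sortedP _ tt rr (ord_sym rr tt o)).
rewrite /before; split=> h i j ij.
  rewrite (zalt_sym rr tt i) (zalt_sym rr tt j); case: eqP ij h => [_|m0] ij h; first by apply: h; case: ij => ij; [apply: Or32|apply: Or31|apply: Or33]; lia.
  rewrite -(zalt_periodic (-1 - i) 1 o) -(zalt_periodic (-1 - j) 1 o); apply: h; lia.
rewrite (zalt_sym tt rr i) (zalt_sym tt rr j); case: eqP ij h => [_|m0] ij h; first by apply: h; case: ij => ij; [apply: Or32|apply: Or31|apply: Or33]; lia.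
have o' := ord_sym rr tt o.
rewrite -(zalt_periodic (-1 - i) 1 o') -(zalt_periodic (-1 - j) 1 o'); apply: h; lia.
Qed.
End Alternating.

(** * Length and inversions in a Coxeter system *)

Section Coxeter.
Variables (W : groupType) (S : set W).
Hypothesis hS : coxeter_system S.

Local Notation T := (reflections S).
Local Notation len := (len S).

Lemma simple_sq s : S s -> s * s = 1.
Proof.
move=> Ss; have [m [m1 _ _] [_ rel _]] := hS.
by have := rel s s Ss Ss; rewrite m1.
Qed.

Lemma simple_inv s : S s -> s^-1 = s.
Proof. by move=> /simple_sq/mulg1_eq. Qed.

Lemma word_exists w : exists n, has_word S w n.
Proof.
have [m _ [gen _ _]] := hS.
have : generated S w by rewrite gen.
suff: generated S `<=` [set w | exists n, has_word S w n] by apply.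
apply: smallest_sub.
- split=> /=; first by exists 0%N, [::]; rewrite big_nil.
  + move=> x y [n [u [_ Su <-]]] [k [v [_ Sv <-]]].
    exists (size (u ++ v)), (u ++ v); split=> //; last by rewrite big_cat.
    by move=> a; rewrite mem_cat => /orP[/Su|/Sv].
  + move=> x [n [u [_ Su <-]]]; exists (size u), (rev u).
    split; [by rewrite size_rev|by move=> a; rewrite mem_rev => /Su|].
    have := prodgV (rev u) xpredT (fun a : W => a); rewrite revK => <-.
    by apply: eq_big_seq => a; rewrite mem_rev => /Su/simple_inv.
- move=> s Ss /=; exists 1%N, [:: s]; split=> //; last by rewrite big_seq1.
  by move=> a; rewrite inE => /eqP->.
Qed.

Lemma lenP w : has_word S w (len w) /\ forall k, has_word S w k -> (len w <= k)%N.
Proof.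
rewrite /Defs.len; set X := [set n | _]; suff: X (get X) by [].
apply: getPex.
have [n wn] := word_exists w.
have ex : exists n, `[< has_word S w n >] by exists n; apply/asboolP.
case: (ex_minnP ex) => k /asboolP wk kmin.
by exists k; split=> // j /asboolP/kmin.
Qed.

Lemma reduced_word w : exists l : seq W,
  [/\ size l = len w, forall a, a \in l -> S a & \prod_(a <- l) a = w].
Proof. by have [h _] := lenP w. Qed.

Lemma len_le_word (l : seq W) : (forall a, a \in l -> S a) ->
  (len (\prod_(a <- l) a) <= size l)%N.
Proof. by move=> Sl; apply: (lenP _).2; exists l. Qed.

Lemma len1 : len 1 = 0%N.
Proof.
by apply/eqP; rewrite -leqn0; have := @len_le_word [::]; rewrite big_nil; apply.
Qed.

Lemma len0 w : len w = 0%N -> w = 1.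
Proof.
have [l [<- _ <-]] := reduced_word w.
by move=> /eqP; rewrite size_eq0 => /eqP->; rewrite big_nil.
Qed.

Lemma simple_refl s : S s -> T s.
Proof. by move=> Ss; exists 1, s => //; rewrite invg1 mulg1 mul1g. Qed.

Lemma refl_conj t x : T t -> T (t ^ x).
Proof.
move=> [w [s Ss ->]]; exists (x^-1 * w), s => //.
by rewrite conjgE invgM invgK !mulgA.
Qed.

Lemma refl_sq t : T t -> t * t = 1.
Proof.
move=> [w [s Ss ->]].
by rewrite -!mulgA mulKg [s * _ in X in _ * X]mulgA simple_sq// mul1g mulgV.
Qed.

Lemma refl_inv t : T t -> t^-1 = t.
Proof. by move=> /refl_sq/mulg1_eq. Qed.

(** The factors of (st)^n contribute the first 2n reflections of the sequence
   s, sts, ststs, ...; when (st)^n = 1 each of them occurs twice and they cancel. *)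
Lemma flip_expg (s t : W) n : s * s = 1 -> t * t = 1 ->
  ((((eq_op^~ s, s) : flip_group W) * ((eq_op^~ t, t) : flip_group W)) ^+ n).1
  = (fun p => \big[addb/false]_(0 <= j < n.*2) (p == (s * t) ^+ j * s)).
Proof.
move=> ss tt; have sV := mulg1_eq ss; have tV := mulg1_eq tt.
set x := _ * _.
have x2 k : (x ^+ k).2 = (s * t) ^+ k.
  by elim: k => [|k IH] //; rewrite !expgSr /= IH.
elim: n => [|n IH]; first by apply/funext => p; rewrite big_geq.
have swapE : (s * t) ^+ n * (s * (s * t) ^- n) = (s * t) ^+ n.*2 * s.
  by rewrite dihedral_swap// mulgA -expgnDr addnn.
apply/funext => p; rewrite expgSr /= IH x2 doubleS !big_nat_recr//= -!addbA.
congr (_ (+) (_ (+) _)).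
- by rewrite eq_conjg conjgE invgK swapE.
- rewrite !eq_conjg; congr (_ == _); rewrite !conjgE !invgK.
  have -> : (s * t) ^+ n * (s * (t * s^-1) * (s * t) ^- n) =
      (s * t) ^+ n * (s * t) * (s * (s * t) ^- n) by rewrite sV !mulgA.
  by rewrite dihedral_swap// mulgA -expgSr -expgnDr addSn addnn.
Qed.

Lemma cocycle_exists : exists nh : W -> W -> bool,
  (forall s p, S s -> nh s p = (p == s)) /\
  (forall x y p, nh (x * y) p = nh x p (+) nh y (p ^ x)).
Proof.
have [m mP [gen rel univ]] := hS.
pose f (s : W) : flip_group W := (eq_op^~ s, s).
have relf : coxeter_relations S m f.
  move=> s t Ss St; rewrite [LHS]surjective_pairing.
  have fE2 k : ((f s * f t) ^+ k).2 = (s * t) ^+ k.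
    by elim: k => [|k IH] //; rewrite !expgSr /= IH.
  congr pair; last by rewrite fE2 rel.
  rewrite flip_expg ?simple_sq//; apply/funext => p.
  rewrite -addnn (@big_cat_nat _ _ _ (m s t)) ?leq_addr//=.
  rewrite -{2}[m s t]add0n big_addn addnK.
  rewrite [X in _ (+) X](eq_bigr (fun j => p == (s * t) ^+ j * s)) ?addbb// => j _.
  by rewrite expgnDr rel// mulg1.
have [phi phiM phiS] := univ _ _ relf.
have phi2 w : (phi w).2 = w.
  have [l [_ Sl <-]] := reduced_word w.
  elim: l Sl => [|a l IH] Sl.
    rewrite !big_nil; have: (phi 1).2 * (phi 1).2 = (phi 1).2.
      by rewrite -[LHS]/(phi 1 * phi 1).2 -phiM mulg1.
    by move=> /(canRL (mulKg _)); rewrite mulVg.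
  have Sa : S a by apply: Sl; rewrite mem_head.
  by rewrite big_cons phiM /= phiS// IH// => b bl; apply: Sl; rewrite inE bl orbT.
exists (fun w => (phi w).1); split=> [s p Ss|x y p]; first by rewrite phiS.
by rewrite phiM /= phi2.
Qed.

Definition inv (w p : W) : bool := `[< left_inversions S w p >].

(** The cocycle given by the presentation is contained in the inversion set, since
   its elements shorten words. Conversely a reflection [t] lies in its own
   cocycle, so if [t] is not in the cocycle of [w] then it is in that of [t * w],
   and [t] shortens [t * w] instead of [w]. *)
Lemma inv_cocycle_spec :
  (forall s p, S s -> inv s p = (p == s)) /\
  (forall x y p, inv (x * y) p = inv x p (+) inv y (p ^ x)).
Proof.
have [nh [nhS nhM]] := cocycle_exists.
have nh1 p : nh 1 p = false.
  by have := nhM 1 1 p; rewrite mulg1 conjg1 addbb.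
(* Each letter of a word contributes one element to the cocycle; deleting the
   letter amounts to multiplying the word by this element on the left. *)
have nhP w p : nh w p -> T p /\ (len (p * w) < len w)%N.
  have [l [<- Sl <-]] := reduced_word w.
  have key : (nh (\prod_(a <- l) a) p -> T p /\ exists l' : seq W,
      [/\ (size l' < size l)%N, forall a, a \in l' -> S a
        & p * \prod_(a <- l) a = \prod_(a <- l') a]).
    elim: l p Sl => [|a l IH] p Sl; first by rewrite big_nil nh1.
    have Sa : S a by apply: Sl; rewrite mem_head.
    have Sl' b : b \in l -> S b by move=> bl; apply: Sl; rewrite inE bl orbT.
    rewrite big_cons nhM nhS//; case: eqP => [-> _|_ /= /IH[]// Tp [l' [sl' Sl'' e]]].
      split; first exact: simple_refl.
      by exists l; split=> //; rewrite mulgA simple_sq// mul1g.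
    split; first by rewrite -[p](conjgK a); exact: refl_conj.
    exists (a :: l'); split=> //.
      by move=> b; rewrite inE => /orP[/eqP->|/Sl''].
    by rewrite big_cons -e conjgE !mulgA mulgV mul1g.
  move=> /key[Tp [l' [sl' Sl' ->]]]; split=> //.
  exact: leq_ltn_trans (len_le_word Sl') sl'.
have nhT t : T t -> nh t t.
  move=> [w [s Ss ->]]; rewrite !nhM (nhS s)//.
  have e : (w * s * w^-1) ^ w = s by rewrite conjgE !mulgA mulVg mul1g mulgVK.
  rewrite e conjgM e conj_by_self.
  rewrite eqxx.
  have := nh1 (w * s * w^-1); rewrite -(mulgV w) nhM e.
  by case: (nh w _); case: (nh _ _).
have invE w p : inv w p = nh w p.
  apply/asboolP/idP => [[Tp lp]|/nhP//]; apply: contraLR lp => np.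
  have /nhP[_] : nh (p * w) p by rewrite nhM nhT// conj_by_self (negPf np).
  by rewrite mulgA refl_sq// mul1g -leqNgt => /ltnW.
by split=> *; rewrite !invE; [exact: nhS|exact: nhM].
Qed.

Lemma inv_simple s p : S s -> inv s p = (p == s).
Proof. exact: inv_cocycle_spec.1. Qed.

Lemma invM x y p : inv (x * y) p = inv x p (+) inv y (p ^ x).
Proof. exact: inv_cocycle_spec.2. Qed.

Lemma inv1 p : inv 1 p = false.
Proof. by have := invM 1 1 p; rewrite mulg1 conjg1 addbb. Qed.

Lemma len_reflMl w t : T t -> (len (t * w) < len w)%N = inv w t.
Proof. by move=> Tt; apply/idP/asboolP => [|[]]. Qed.

Lemma inv_self t : T t -> inv t t.
Proof.
move=> Tt; rewrite -len_reflMl// refl_sq// len1 lt0n; apply/eqP => /len0 t1.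
have [w [s Ss tE]] := Tt; have s1 : s = 1.
  by rewrite -[RHS](conj1g w) -t1 tE conjgE !mulgA mulVg mul1g mulgVK.
by have := inv_simple s Ss; rewrite eqxx s1 inv1.
Qed.

Lemma len_reflMlN w t : T t -> (len w < len (t * w))%N = ~~ inv w t.
Proof.
move=> Tt; rewrite -{1}[w]mul1g -(refl_sq Tt) -mulgA len_reflMl//.
by rewrite invM inv_self// conj_by_self.
Qed.

(** The edge of the Bruhat graph from [c] to [c * t], labelled by right
   multiplication, descends. *)
Definition dn (c t : W) : bool := inv c (t ^ c^-1).

Lemma mulg_conjV (c t : W) : c * t = t ^ c^-1 * c.
Proof. by rewrite conjgE invgK mulgA mulgVK. Qed.

Lemma len_dn c t : T t -> (len (c * t) < len c)%N = dn c t.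
Proof. by move=> Tt; rewrite mulg_conjV len_reflMl//; exact: refl_conj. Qed.

Lemma len_up c t : T t -> (len c < len (c * t))%N = ~~ dn c t.
Proof. by move=> Tt; rewrite mulg_conjV len_reflMlN//; exact: refl_conj. Qed.

(** The rule behind the whole proof: right translation by [x] reverses exactly the
   edges whose label is an inversion of [x]. *)
Lemma dnMr c x t : dn (c * x) (t ^ x) = dn c t (+) inv x t.
Proof.
rewrite /dn -conjgM invgM mulgA mulgV mul1g.
by rewrite invM -conjgM mulVg conjg1.
Qed.

Lemma dnMs s c t : S s -> dn (s * c) t = (t ^ c^-1 == s) (+) dn c t.
Proof.
move=> Ss; rewrite /dn invM -conjgM invgM -mulgA mulVg mulg1 inv_simple//.
by rewrite conjgM [in LHS]eq_conjg invgK conj_by_self.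
Qed.

Lemma dn_edge c t : T t -> dn (c * t) t = ~~ dn c t.
Proof.
by move=> Tt; rewrite -{2}(conj_by_self t) dnMr inv_self// addbT.
Qed.

Lemma len_mulg_le x y : (len (x * y) <= len x + len y)%N.
Proof.
have [u [<- Su <-]] := reduced_word x; have [v [<- Sv <-]] := reduced_word y.
rewrite -big_cat/= -size_cat; apply: len_le_word => a.
by rewrite mem_cat => /orP[/Su|/Sv].
Qed.

Lemma len_simple s : S s -> (len s <= 1)%N.
Proof.
move=> Ss; have := @len_le_word [:: s]; rewrite big_seq1; apply=> a.
by rewrite inE => /eqP->.
Qed.

Lemma len_simpleMr c s : S s -> len (c * s) = if dn c s then (len c).-1 else (len c).+1.
Proof.
move=> Ss; have Ts := simple_refl Ss; have := len_dn c Ts; have := len_up c Ts.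
have := len_mulg_le c s; have := len_simple Ss.
have := len_mulg_le (c * s) s; rewrite -mulgA simple_sq// mulg1.
by case: dn => /=; lia.
Qed.

Lemma len_simpleMl c s : S s -> len (s * c) = if inv c s then (len c).-1 else (len c).+1.
Proof.
move=> Ss; have Ts := simple_refl Ss; have := len_reflMl c Ts; have := len_reflMlN c Ts.
have := len_mulg_le s c; have := len_simple Ss.
have := len_mulg_le s (s * c); rewrite mulgA simple_sq// mul1g.
by case: inv => /=; lia.
Qed.

Lemma len_gt0_dn c s : S s -> dn c s -> (0 < len c)%N.
Proof. by move=> /simple_refl Ts; rewrite -len_dn// => /(leq_trans _); apply. Qed.

Lemma len_gt0_inv c s : T s -> inv c s -> (0 < len c)%N.
Proof. by move=> Ts; rewrite -len_reflMl// => /(leq_trans _); apply. Qed.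

Lemma odd_len_simple c s : S s -> odd (len (s * c)) = ~~ odd (len c).
Proof.
move=> Ss; rewrite len_simpleMl//; case: ifP => // /(len_gt0_inv (simple_refl Ss)).
by case: (len c) => //= n _; rewrite negbK.
Qed.

Lemma odd_lenM x y : odd (len (x * y)) = odd (len x) (+) odd (len y).
Proof.
have [l [_ Sl <-]] := reduced_word x.
elim: l Sl => [|a l IH] Sl; first by rewrite big_nil mul1g len1.
have Sa : S a by apply: Sl; rewrite mem_head.
rewrite big_cons -mulgA !(odd_len_simple _ Sa) IH ?addNb// => b bl.
by apply: Sl; rewrite inE bl orbT.
Qed.

Lemma odd_len_refl t : T t -> odd (len t).
Proof.
move=> [w [s Ss ->]]; rewrite !odd_lenM.
have -> : odd (len s) by have := odd_len_simple 1 Ss; rewrite mulg1 len1.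
have := odd_lenM w w^-1; rewrite mulgV len1.
by move: (odd (len w)) (odd (len w^-1)) => [] [].
Qed.

Lemma exists_descent v : v != 1 -> exists2 s, S s & dn v s.
Proof.
move=> v1; have [l [sl Sl vE]] := reduced_word v.
case/lastP: l => [|l s] in sl Sl vE *; first by rewrite -vE big_nil eqxx in v1.
have Ss : S s by apply: Sl; rewrite mem_rcons mem_head.
exists s => //; rewrite -len_dn; last exact: simple_refl.
rewrite -sl size_rcons -vE -cats1 big_cat big_seq1/= -mulgA simple_sq// mulg1.
by rewrite ltnS; apply: len_le_word => a al; apply: Sl; rewrite mem_rcons inE al orbT.
Qed.

Lemma exists_left_descent v : v != 1 -> exists2 s, S s & inv v s.
Proof.
move=> v1; have [[|s l] [sl Sl vE]] := reduced_word v.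
  by rewrite -vE big_nil eqxx in v1.
have Ss : S s by apply: Sl; rewrite mem_head.
exists s => //; rewrite -len_reflMl; last exact: simple_refl.
rewrite -sl -vE big_cons mulgA simple_sq// mul1g ltnS.
by apply: len_le_word => a al; apply: Sl; rewrite inE al orbT.
Qed.

(** * Bruhat order *)

Local Notation "u <=b v" := (bruhat S u v) (at level 70).

Lemma bruhat_refl u : u <=b u. Proof. exact: rt_refl. Qed.

Lemma bruhat_trans v u w : u <=b v -> v <=b w -> u <=b w.
Proof. exact: rt_trans. Qed.

Lemma bruhat_up u t : T t -> ~~ dn u t -> u <=b u * t.
Proof. by move=> Tt ut; apply: rt_step; split; [exists t|rewrite len_up]. Qed.

Lemma bruhat_dn u t : T t -> dn u t -> u * t <=b u.
Proof.
move=> Tt ut; have := @bruhat_up (u * t) t Tt.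
by rewrite dn_edge// negbK -mulgA refl_sq// mulg1; apply.
Qed.

Lemma bruhat_ind (P : W -> W -> Prop) : (forall u, P u u) ->
  (forall u t, T t -> ~~ dn u t -> P u (u * t)) ->
  (forall u v w, P u v -> P v w -> P u w) ->
  forall u v, u <=b v -> P u v.
Proof.
move=> Pr Ps Pt u v; elim=> [{}u {}v [[t Tt ->]]|//|{}u {}v w _ uv _ vw].
  by rewrite len_up// => ut; exact: Ps.
exact: Pt vw.
Qed.

Lemma bruhat_len u v : u <=b v -> (len u <= len v)%N /\ (len u = len v -> u = v).
Proof.
elim/bruhat_ind: u v / => [u|u t Tt ut|u v w [uv uv'] [vw vw']]; first by [].
  have := ut; rewrite -len_up// => h; split; first exact: ltnW.
  by move=> e; rewrite e ltnn in h.
split=> [|e]; first exact: leq_trans vw.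
have vu : len v = len u by lia.
by rewrite (uv' (esym vu)); apply: vw'; lia.
Qed.

Lemma bruhat_anti u v : u <=b v -> v <=b u -> u = v.
Proof.
by move=> /bruhat_len[uv e] /bruhat_len[vu _]; apply: e; lia.
Qed.

Lemma mulss c s : S s -> c * s * s = c.
Proof. by move=> Ss; rewrite -mulgA simple_sq// mulg1. Qed.

Lemma dn_simple c s : S s -> dn (c * s) s = ~~ dn c s.
Proof. by move=> /simple_refl; exact: dn_edge. Qed.

Definition pair_min s c := if dn c s then c * s else c.
Definition pair_max s c := if dn c s then c else c * s.

Lemma pair_min_le s c : S s -> pair_min s c <=b c /\ pair_min s c <=b c * s.
Proof.
move=> Ss; have Ts := simple_refl Ss; rewrite /pair_min; case: ifP => [d|/negbT d].
  by split; [exact: bruhat_dn|exact: bruhat_refl].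
by split; [exact: bruhat_refl|exact: bruhat_up].
Qed.

Lemma le_pair_max s c : S s -> c <=b pair_max s c /\ c * s <=b pair_max s c.
Proof.
move=> Ss; have Ts := simple_refl Ss; rewrite /pair_max; case: ifP => [d|/negbT d].
  by split; [exact: bruhat_refl|exact: bruhat_dn].
by split; [exact: bruhat_up|exact: bruhat_refl].
Qed.

Lemma dnJ c t s : S s -> dn (c * s) (t ^ s) = dn c t (+) (t == s).
Proof. by move=> Ss; rewrite dnMr inv_simple. Qed.

(** A simple reflection reverses only the edges labelled by itself, so every other
   ascending edge is carried to an ascending edge, and the two parallel edges
   compare the smaller and the larger elements of the two pairs. *)
Lemma bruhat_lift s u v : S s -> u <=b v ->
  pair_min s u <=b pair_min s v /\ pair_max s u <=b pair_max s v.
Proof.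
move=> Ss; have Ts := simple_refl Ss.
elim/bruhat_ind: u v / => [u|u t Tt ut|u v w [h1 h2] [h3 h4]].
- by split; exact: bruhat_refl.
- case: (eqVneq t s) ut => [-> ut|ts ut].
    by rewrite /pair_min /pair_max dn_simple// (negPf ut) /= mulss//; split; exact: bruhat_refl.
  have e : u * s * t ^ s = u * t * s by rewrite conjgE !mulgA mulgK.
  have us : u * s <=b u * t * s.
    by rewrite -e; apply: bruhat_up; [exact: refl_conj|rewrite dnJ// (negPf ts) addbF].
  have uu : u <=b u * t by exact: bruhat_up.
  have [l1 l2] := pair_min_le u Ss; have [h1 h2] := le_pair_max (u * t) Ss.
  split.
    by rewrite {2}/pair_min; case: ifP => _; [exact: bruhat_trans us|exact: bruhat_trans uu].
  by rewrite {1}/pair_max; case: ifP => _; [exact: bruhat_trans h1|exact: bruhat_trans h2].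
- by split; [exact: bruhat_trans h3|exact: bruhat_trans h4].
Qed.

Lemma lift_le u v s : S s -> u <=b v -> ~~ dn u s -> dn v s -> u <=b v * s.
Proof. by move=> Ss /(bruhat_lift Ss)[h _] /negPf du dv; rewrite /pair_min du dv in h. Qed.

Lemma lift_up u v s : S s -> u <=b v -> dn v s -> u * s <=b v.
Proof.
move=> Ss /(bruhat_lift Ss)[_ +] dv; rewrite {2}/pair_max dv.
exact: bruhat_trans (le_pair_max u Ss).2.
Qed.

Lemma lower_finite v : exists2 l : seq W, uniq l & forall u, u \in l <-> u <=b v.
Proof.
suff [l lP] : exists l : seq W, forall u, u <=b v -> u \in l.
  exists (undup [seq u <- l | `[< u <=b v >]]); first exact: undup_uniq.
  move=> u; rewrite mem_undup mem_filter; split=> [/andP[/asboolP]//|uv].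
  by rewrite lP// andbT; apply/asboolP.
have [n] := ubnP (len v); elim: n v => // n IH v vn.
have [->|/exists_descent[s Ss dv]] := eqVneq v 1.
  exists [:: 1] => u /bruhat_len[]; rewrite len1 leqn0 => /eqP u0 _.
  by rewrite (len0 u0) mem_head.
have [|l lP] := IH (v * s).
  by rewrite len_simpleMr// dv; have := len_gt0_dn Ss dv; lia.
exists (l ++ map (fun u => u * s) l) => u uv; rewrite mem_cat.
have [+ _] := bruhat_lift Ss uv; rewrite /pair_min dv; case: ifP => _ /lP => [h|->//].
by apply/orP; right; apply/mapP; exists (u * s) => //; rewrite mulss.
Qed.

(** * Labelled paths in the Bruhat graph *)

Definition endpt (u : W) (l : seq W) : W := u * \prod_(t <- l) t.

Fixpoint up_path (u : W) (l : seq W) : Prop :=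
  if l is t :: l' then [/\ T t, ~~ dn u t & up_path (u * t) l'] else True.

(** Every step raises the length, so the equation on lengths forces each step to
   raise it by exactly one. *)
Definition sat (u : W) (l : seq W) : Prop :=
  up_path u l /\ len (endpt u l) = (len u + size l)%N.

Lemma endpt_nil u : endpt u [::] = u.
Proof. by rewrite /endpt big_nil mulg1. Qed.

Lemma endpt_cons u t l : endpt u (t :: l) = endpt (u * t) l.
Proof. by rewrite /endpt big_cons mulgA. Qed.

Lemma endpt_cat u k l : endpt u (k ++ l) = endpt (endpt u k) l.
Proof. by rewrite /endpt big_cat mulgA. Qed.

Lemma up_path_cat u k l : up_path u (k ++ l) <-> up_path u k /\ up_path (endpt u k) l.
Proof.
elim: k u => [|t k IH] u /=; first by rewrite endpt_nil; split=> [|[]].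
rewrite endpt_cons; split.
  by move=> [Tt ut /IH[]].
by move=> [[Tt ut uk] kl]; split=> //; apply/IH.
Qed.

Lemma up_path_len u l : up_path u l -> (len u + size l <= len (endpt u l))%N.
Proof.
elim: l u => [|t l IH] u /=; first by rewrite endpt_nil addn0.
move=> [Tt ut /IH]; rewrite endpt_cons; have := ut; rewrite -len_up//; lia.
Qed.

Lemma up_path_le u l : up_path u l -> u <=b endpt u l.
Proof.
elim: l u => [|t l IH] u /=; first by rewrite endpt_nil => _; exact: bruhat_refl.
by move=> [Tt ut /IH]; rewrite endpt_cons; apply: bruhat_trans; exact: bruhat_up.
Qed.

Lemma up_path_refl u l : up_path u l -> {in l, forall t, T t}.
Proof.
elim: l u => [|t l IH] u //= [Tt _ /IH h] r.
by rewrite inE => /orP[/eqP->|/h].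
Qed.

Lemma sat_cat u k l : sat u (k ++ l) <-> sat u k /\ sat (endpt u k) l.
Proof.
rewrite /sat endpt_cat size_cat; split.
  move=> [/up_path_cat[uk kl]]; have := up_path_len uk; have := up_path_len kl.
  by move=> h1 h2 h3; split; split=> //; lia.
move=> [[uk h1] [kl h2]]; split; first exact/up_path_cat.
lia.
Qed.

Lemma sat_cons u t l : sat u (t :: l) <->
  [/\ T t, len (u * t) = (len u).+1 & sat (u * t) l].
Proof.
rewrite -cat1s sat_cat endpt_cons endpt_nil /sat endpt_cons endpt_nil /= addn1.
split; first by move=> [[[]]].
move=> [Tt e [h1 h2]]; split=> //; split=> //.
by split=> //; rewrite -len_up// e.
Qed.

Lemma sat_nil u : sat u [::].
Proof. by split; rewrite ?endpt_nil ?addn0. Qed.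

Lemma sat_le u l : sat u l -> u <=b endpt u l.
Proof. by move=> [/up_path_le]. Qed.

(** [s] is the only inversion of [s], so translation by [s] keeps the direction of
   all edges with another label. *)
Lemma up_path_conj s u l : S s -> up_path u l -> s \notin l ->
  up_path (u * s) [seq t ^ s | t <- l] /\ endpt (u * s) [seq t ^ s | t <- l] = endpt u l * s.
Proof.
move=> Ss; elim: l u => [|t l IH] u /=; first by rewrite !endpt_nil.
move=> [Tt ut /IH{}IH]; rewrite inE negb_or eq_sym => /andP[ts /IH[h1 h2]].
have e : u * s * t ^ s = u * t * s by rewrite conjgE !mulgA mulgK.
rewrite !endpt_cons e; split=> //; split=> //; first exact: refl_conj.
by rewrite dnJ// (negPf ts) addbF.
Qed.
(** * Reflection subgroups *)

Lemma generated_subgroup (A : set W) : is_subgroup (generated A).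
Proof.
split=> [M [[]]//|x y Ax Ay M MP|x Ax M MP].
  by have [[_ h _] _] := MP; apply: h; [exact: Ax|exact: Ay].
by have [[_ _ h] _] := MP; apply: h; exact: Ax.
Qed.

Lemma sub_generated (A : set W) : A `<=` generated A.
Proof. exact: sub_gen_smallest. Qed.

Lemma generated_min (A H : set W) : is_subgroup H -> A `<=` H -> generated A `<=` H.
Proof. exact: smallest_sub. Qed.

Lemma canonicalP (H : set W) t : canonical_generators S H t <->
  [/\ T t, H t & forall p, H p -> inv t p -> p = t].
Proof.
split=> [[Tt e]|[Tt Ht h]].
  have : (left_inversions S t `&` H) t by rewrite e.
  move=> [_ Ht]; split=> // p Hp /asboolP tp.
  by have : (left_inversions S t `&` H) p by []; rewrite e.
split=> //; apply/seteqP; split=> p /=; first by move=> [/asboolT tp Hp]; exact: h.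
by move=> ->; split=> //; apply/asboolP; exact: inv_self.
Qed.

Lemma canonical_inv (H : set W) t p : canonical_generators S H t -> H p ->
  inv t p = (p == t).
Proof.
move=> /canonicalP[Tt Ht h] Hp; apply/idP/eqP => [|->]; first exact: h.
exact: inv_self.
Qed.

Lemma canonical_simple (H : set W) s : S s -> H s -> canonical_generators S H s.
Proof.
move=> Ss Hs; apply/canonicalP; split=> //; first exact: simple_refl.
by move=> p _; rewrite inv_simple// => /eqP.
Qed.

Definition conj_set (H : set W) (s : W) : set W := [set h | H (h ^ s)].

Lemma conj_subgroup (H : set W) s : is_subgroup H -> is_subgroup (conj_set H s).
Proof.
move=> [H1 HM HV]; split=> [|x y Hx Hy|x Hx]; rewrite /conj_set /=.
- by rewrite conj1g.
- by rewrite conjMg; exact: HM.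
- by rewrite conjVg; exact: HV.
Qed.

Lemma conjKs s (x : W) : S s -> (x ^ s) ^ s = x.
Proof. by move=> Ss; rewrite -conjgM simple_sq// conjg1. Qed.

Lemma subgroup_conj (H : set W) (x y : W) : is_subgroup H -> H x -> H y -> H (x ^ y).
Proof.
by move=> [_ HM HV] Hx Hy; rewrite conjgE; apply: HM (HM _ _ Hx Hy); exact: HV.
Qed.

Lemma inv_conj s t q : S s -> T t -> inv (t ^ s) q =
  (q == s) (+) (inv t (q ^ s) (+) ((q ^ s) ^ t == s)).
Proof.
move=> Ss Tt; rewrite conjgE simple_inv// invM inv_simple// invM.
by rewrite [inv s _]inv_simple.
Qed.

(** The inversions of [t ^ s] and the conjugates of those of [t] differ only in [s]
   and in conjugates of [s] under the subgroup, which lie outside it. *)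
Lemma canonical_conj (H : set W) s t : is_subgroup H -> S s -> ~ H s ->
  canonical_generators S (conj_set H s) t <-> canonical_generators S H (t ^ s).
Proof.
move=> Hg Ss Hs.
have ss : ~ conj_set H s s by rewrite /conj_set /= conj_by_self.
have key u p : T u -> conj_set H s u -> conj_set H s p -> inv (u ^ s) (p ^ s) = inv u p.
  move=> Tu Hu Hp; rewrite inv_conj// conjKs//; case: eqP => [e|_].
    by case: Hs; rewrite -e.
  case: eqP => [e|_]; last by rewrite addbF.
  case: ss; rewrite -[X in conj_set _ _ X]e; apply: subgroup_conj => //.
  exact: conj_subgroup.
split=> /canonicalP[Tt Ht h]; apply/canonicalP.
  split=> [||p Hp tp]; [exact: refl_conj|by []|].
  rewrite -[p](conjKs _ Ss) (h (p ^ s))//; first by rewrite /conj_set /= conjKs.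
  by rewrite -key// ?/conj_set /= conjKs.
have Tt' : T t by rewrite -[t](conjKs _ Ss); exact: refl_conj.
split=> // p Hp tp; rewrite -[p](conjKs _ Ss) (h (p ^ s)) ?conjKs// key//.
Qed.

(** Write [t = w r w^-1]. Apart from [t] itself, an inversion of [t] lies in exactly
   one of [N w] and [t N(w) t]; an element commuting with [t] lies in both or in
   neither. *)
Lemma inv_commuting t s : T t -> s != t -> s ^ t = s -> inv t s = false.
Proof.
move=> [w [r Sr ->]] st stE.
rewrite !invM (inv_simple _ Sr).
have -> : (s ^ w == r) = (s == w * r * w^-1) by rewrite eq_conjg [in LHS]conjgE invgK mulgA.
rewrite (negPf st) addbF.
have -> : s ^ (w * r) = s ^ w by rewrite -[RHS](congr1 (fun z => z ^ w) stE) -conjgM mulgVK.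
by rewrite -invM mulgV inv1.
Qed.

Lemma refl_descend t : T t -> ~ S t -> exists2 s, S s & (len (t ^ s) < len t)%N.
Proof.
move=> Tt nSt; have t1 : t != 1.
  by apply/eqP => t1; have := odd_len_refl Tt; rewrite t1 len1.
have [s Ss st] := exists_left_descent t1.
have sNt : s <> t by move=> e; apply: nSt; rewrite -e.
exists s => //.
have Ts := simple_refl Ss.
have l1 : (len (s * t) < len t)%N by rewrite len_reflMl.
suff : (len (s * t * s) < len (s * t))%N.
  by move=> l2; rewrite conjgE simple_inv// mulgA; exact: ltn_trans l1.
rewrite len_dn// dnMs// /dn (refl_inv Tt).
case: eqP => [e|ne] /=; last first.
  by have := inv1 s; rewrite -(refl_sq Tt) invM st; case: (inv t (s ^ t)).
by have := inv_commuting Tt (introN eqP sNt) e; rewrite st.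
Qed.

(** Conjugation by a simple reflection outside [H] transports the claim to a
   shorter reflection of another subgroup; a simple reflection in [H] is itself
   a canonical generator. *)
Lemma refl_in_generated (H : set W) t : is_subgroup H -> T t -> H t ->
  generated (canonical_generators S H) t.
Proof.
have [n] := ubnP (len t); elim: n t H => // n IH t H tn Hg Tt Ht.
have [St|nSt] := pselect (S t).
  by apply: sub_generated; exact: canonical_simple.
have [s Ss lts] := refl_descend Tt nSt.
have ltsn : (len (t ^ s) < n)%N by lia.
have [Hs|nHs] := pselect (H s).
  have Cs : generated (canonical_generators S H) s.
    by apply: sub_generated; exact: canonical_simple.
  rewrite -[t](conjKs _ Ss); apply: (subgroup_conj (generated_subgroup _)) => //.
  by apply: IH => //; [exact: refl_conj|exact: subgroup_conj].
have : generated (canonical_generators S (conj_set H s)) (t ^ s).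
  by apply: IH => //; [exact: conj_subgroup|exact: refl_conj|rewrite /conj_set /= conjKs].
have /generated_min : is_subgroup (conj_set (generated (canonical_generators S H)) s).
  exact/conj_subgroup/generated_subgroup.
move=> h /h; rewrite /conj_set /= conjKs//; apply=> u /(canonical_conj _ Hg Ss nHs).
exact: sub_generated.
Qed.

Lemma odd_lenV x : odd (len x^-1) = odd (len x).
Proof.
have := odd_lenM x x^-1; rewrite mulgV len1.
by move: (odd (len x)) (odd (len x^-1)) => [] [].
Qed.

(** Reflections have odd length, and the parity of the length is multiplicative;
   so the rotations of a dihedral subgroup are not reflections. *)
Lemma even_rotation (r t : W) i : T r -> T t -> odd (len (zexp (r * t) i)) = false.
Proof.
move=> Tr Tt; have e : odd (len (r * t)) = false.
  by rewrite odd_lenM !odd_len_refl.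
have eX n : odd (len ((r * t) ^+ n)) = false.
  by elim: n => [|n IH]; rewrite ?len1// expgS odd_lenM e IH.
by rewrite /zexp; case: ifP => _; rewrite ?odd_lenV.
Qed.

Lemma refl_zalt (r t : W) i : T r -> T t -> T (zalt r t i).
Proof.
move=> Tr Tt; have rr := refl_sq Tr; have tt := refl_sq Tt.
have [k [->|->]] : exists k, i = (2 * k)%Z \/ i = (2 * k - 1)%Z.
- by have [[k h]|[k h]] := Z.Even_or_Odd i; [exists k; left|exists (k + 1)%Z; right]; lia.
- rewrite (_ : 2 * k = 2 * k - 0)%Z; last lia.
  by rewrite -zalt_conj_zalt// zalt0; exact: refl_conj.
- rewrite (_ : 2 * k - 1 = 2 * (k - 1) - (-1))%Z; last lia.
  by rewrite -zalt_conj_zalt// zaltm1//; exact: refl_conj.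
Qed.

Lemma refl_in_dihedral (r t h : W) : T r -> T t -> generated [set r; t] h -> T h ->
  exists i, h = zalt r t i.
Proof.
move=> Tr Tt Hh Th; have rr := refl_sq Tr; have tt := refl_sq Tt.
suff /(_ h Hh) : generated [set r; t] `<=`
    [set h | exists i, h = zexp (r * t) i \/ h = zalt r t i].
  move=> [i [e|->]]; last by exists i.
  by have := odd_len_refl Th; rewrite e even_rotation.
apply: generated_min; last first.
  move=> _ [->|->]; [exists 0%Z|exists (-1)%Z]; right; first by rewrite zalt0.
  by rewrite zaltm1.
split=> [|_ _ [i [->|->]] [j [->|->]]|_ [i [->|->]]] /=.
- by exists 0%Z; left.
- by exists (i + j)%Z; left; rewrite zexpD.
- by exists (i + j)%Z; right; rewrite zexp_zalt.
- by exists (i - j)%Z; right; rewrite zalt_zexp.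
- by exists (i - j)%Z; left; rewrite zalt_mul.
- by exists (- i)%Z; left; rewrite zexpN.
- by exists i; right; rewrite (mulg1_eq (zalt_sq rr tt i)).
Qed.

Lemma generated_zalt (r t : W) i : generated [set r; t] (zalt r t i).
Proof.
have [H1 HM HV] := generated_subgroup [set r; t].
have Hr : generated [set r; t] r by apply: sub_generated; left.
have Ht : generated [set r; t] t by apply: sub_generated; right.
apply: (HM _ _ _ Hr); have HX n : generated [set r; t] ((r * t) ^+ n).
  by elim: n => [|n IH] //; rewrite expgS; apply: (HM _ _ _ IH); exact: (HM).
by rewrite /zexp; case: ifP => _ //; exact: HV.
Qed.

(** Otherwise the inversions of [c = b a b] force [b] and [a] to commute, and then
   [c = a]. *)
Lemma canonical_conj_neq (H : set W) a b c : is_subgroup H ->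
  canonical_generators S H a -> canonical_generators S H b -> canonical_generators S H c ->
  a <> b -> b <> c -> a <> c -> a ^ b <> c.
Proof.
move=> Hg Ca Cb Cc ab bc ac e.
have [[Ta Ha _] [Tb Hb _]] := ((canonicalP H a).1 Ca, (canonicalP H b).1 Cb).
have : inv (b * (a * b)) b = (b ^ a != b).
  rewrite !invM conj_by_self inv_self// (canonical_inv Ca Hb) (canonical_inv Cb (subgroup_conj Hg Hb Ha)).
  by rewrite (introF eqP (nesym ab)); case: eqP.
have -> : b * (a * b) = c by rewrite -e conjgE refl_inv.
rewrite (canonical_inv Cc Hb) (introF eqP bc) => /esym/negbFE/eqP ba.
by apply: ac; rewrite -e conjgE -{2}ba -conjgC mulKg.
Qed.

(** Rotations commute, so [a c b = b c a]. Comparing the inversions of both sides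
   shows that any two of three canonical generators commute. The rotations [a b],
   [b c], [a c] would then all have order two, but a cyclic group has at most one
   element of order two. *)
Lemma canonical_triple (r t a b c : W) : T r -> T t ->
  let H := generated [set r; t] in
  canonical_generators S H a -> canonical_generators S H b -> canonical_generators S H c ->
  a <> b -> b <> c -> a <> c -> False.
Proof.
move=> Tr Tt H Ca Cb Cc ab bc ac.
have rr := refl_sq Tr; have tt := refl_sq Tt.
have Hg : is_subgroup H by exact: generated_subgroup.
have idx x : canonical_generators S H x -> exists i, x = zalt r t i.
  by move=> /canonicalP[Tx Hx _]; exact: refl_in_dihedral.
have [m o] := ord_exists (r * t).
have key x y z : canonical_generators S H (zalt r t x) ->
    canonical_generators S H (zalt r t y) -> canonical_generators S H (zalt r t z) ->
    zalt r t x <> zalt r t y -> zalt r t y <> zalt r t z -> zalt r t x <> zalt r t z ->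
    (Z.of_nat m | 2 * (y - z))%Z.
  move=> Cx Cy Cz xy yz xz.
  have [[Tx Hx _] [Ty Hy _]] := ((canonicalP H _).1 Cx, (canonicalP H _).1 Cy).
  have [Tz Hz _] := (canonicalP H _).1 Cz.
  have e : zalt r t x * (zalt r t z * zalt r t y) = zalt r t y * (zalt r t z * zalt r t x).
    by rewrite !zalt_mul// !zalt_zexp//; congr zalt; lia.
  have {e} : inv (zalt r t x * (zalt r t z * zalt r t y)) (zalt r t x) =
      inv (zalt r t y * (zalt r t z * zalt r t x)) (zalt r t x) by rewrite e.
  rewrite !(invM (zalt r t x), invM (zalt r t y), invM (zalt r t z)) conj_by_self.
  rewrite (inv_self Tx).
  rewrite (canonical_inv Cz Hx) (canonical_inv Cy Hx) (introF eqP xy) (introF eqP xz).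
  rewrite (canonical_inv Cy (subgroup_conj Hg Hx Hz)).
  rewrite (introF eqP (canonical_conj_neq Hg Cx Cz Cy _ _ _))//; [|exact: nesym].
  rewrite (canonical_inv Cz (subgroup_conj Hg Hx Hy)).
  rewrite (introF eqP (canonical_conj_neq Hg Cx Cy Cz _ _ _))//=.
  rewrite (canonical_inv Cx (subgroup_conj Hg (subgroup_conj Hg Hx Hy) Hz)) -conjgM.
  rewrite zalt_mul// zalt_conj_zexp// => /esym/eqP/(zalt_eq rr tt _ _ o).
  by rewrite (_ : x - 2 * (y - z) - x = - (2 * (y - z)))%Z ?Z.divide_opp_r//; lia.
have [[x xE] [[y yE] [z zE]]] := (idx _ Ca, (idx _ Cb, idx _ Cc)); subst a b c.
(* both rotations have order two, so their indices are odd multiples of m / 2 *)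
have [k kE] := key _ _ _ Ca Cb Cc ab bc ac.
have [l lE] := key _ _ _ Cb Ca Cc (nesym ab) ac bc.
apply: ab; apply/(zalt_eq rr tt _ _ o).
have kodd : ~ exists i, k = (2 * i)%Z.
  move=> [i ki]; apply: bc; apply/(zalt_eq rr tt _ _ o); exists i; nia.
have lodd : ~ exists i, l = (2 * i)%Z.
  move=> [i li]; apply: ac; apply/(zalt_eq rr tt _ _ o); exists i; nia.
have [[i ki]|[i ki]] := Z.Even_or_Odd k; first by case: kodd; exists i.
have [[j lj]|[j lj]] := Z.Even_or_Odd l; first by case: lodd; exists j.
exists (j - i)%Z; nia.
Qed.

Theorem dihedral_structure t1 t2 : T t1 -> T t2 -> t1 <> t2 ->
  exists r t, [/\ T r, T t, r <> t,
    canonical_generators S (generated [set t1; t2]) = [set r; t] &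
    forall h, T h -> generated [set t1; t2] h -> exists i, h = zalt r t i].
Proof.
move=> T1 T2 t12; set H := generated _.
have Hg : is_subgroup H by exact: generated_subgroup.
have H1 : H t1 by apply: sub_generated; left.
have H2 : H t2 by apply: sub_generated; right.
have Trefl x : canonical_generators S H x -> T x by move=> /canonicalP[].
have [[r [t [Cr Ct rt]]]|no] := pselect (exists r t,
    [/\ canonical_generators S H r, canonical_generators S H t & r <> t]).
  have CE : canonical_generators S H = [set r; t].
    apply/seteqP; split=> [x Cx|x [->|->]//] /=.
    have [?|xr] := pselect (x = r); first by left.
    have [?|xt] := pselect (x = t); first by right.
    by case: (canonical_triple T1 T2 Cr Ct Cx rt (nesym xt) (nesym xr)).
  exists r, t; split=> //; [exact: Trefl|exact: Trefl|] => h Th Hh.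
  apply: refl_in_dihedral => //; [exact: Trefl|exact: Trefl|].
  by rewrite -CE; exact: refl_in_generated.
have sub : generated (canonical_generators S H) `<=`
    [set h | h = 1 \/ canonical_generators S H h].
  apply: generated_min => [|x]; last by right.
  split=> [|x y /= [->|Cx] [->|Cy]|x /= [->|Cx]]; rewrite ?mul1g ?mulg1 ?invg1;
    [by left|by left|by right|by right| |by left|].
    left; have -> : y = x; last exact/refl_sq/Trefl.
    by apply: contrapT => yx; apply: no; exists y, x.
  by right; rewrite refl_inv//; exact: Trefl.
have ne1 x : T x -> x <> 1.
  by move=> Tx x1; have := odd_len_refl Tx; rewrite x1 len1.
have C1 : canonical_generators S H t1.
  by have [/ne1|//] := sub _ (refl_in_generated Hg T1 H1).
have C2 : canonical_generators S H t2.
  by have [/ne1|//] := sub _ (refl_in_generated Hg T2 H2).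
by case: no; exists t1, t2.
Qed.
(** * Conjugating a reflection ordering by a simple reflection *)

Definition flip_lt (lt : W -> W -> Prop) : W -> W -> Prop := fun a b => lt b a.

Lemma before_from0 m j : ~ (Z.of_nat m | j)%Z ->
  exists2 k, before m 0 k & (Z.of_nat m | j - k)%Z.
Proof.
rewrite /before => nj; case: eqP => m0.
  exists j; last by exists 0%Z; lia.
  have : j <> 0%Z by move=> j0; apply: nj; exists 0%Z; lia.
  by case: (Z.lt_trichotomy j 0) => [h|[h|h]] j0; [apply: Or33|lia|apply: Or31]; lia.
have r := Z.mod_pos_bound j (Z.of_nat m) ltac:(lia).
exists (j mod Z.of_nat m)%Z; last first.
  by exists (j / Z.of_nat m)%Z; rewrite Zmod_eq_full; lia.
have : (j mod Z.of_nat m <> 0)%Z by move=> /Z.mod_divide h; apply: nj; apply: h; lia.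
lia.
Qed.

(** The first generator precedes every other reflection of the subgroup. *)
Lemma dihedral_first lt r t i : T r -> T t -> dihedral_sorted lt r t ->
  zalt r t i = r \/ lt r (zalt r t i).
Proof.
move=> Tr Tt; have rr := refl_sq Tr; have tt := refl_sq Tt.
have [m o] := ord_exists (r * t).
rewrite (dihedral_sortedP _ rr tt o) => sorted.
have [i0|/before_from0[k bk ik]] := pselect (Z.of_nat m | i)%Z.
  left; rewrite -[RHS](zalt0 r t); apply/(zalt_eq rr tt _ _ o).
  by rewrite Z.sub_0_r.
right; rewrite (_ : zalt r t i = zalt r t k); last exact/(zalt_eq rr tt _ _ o).
by have := sorted _ _ bk; rewrite zalt0.
Qed.

Lemma dihedral_last lt r t i : T r -> T t -> dihedral_sorted lt r t ->
  zalt r t i = t \/ lt (zalt r t i) t.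
Proof.
move=> Tr Tt; have rr := refl_sq Tr; have tt := refl_sq Tt.
move=> /(dihedral_sorted_sym lt tt rr).2 /(dihedral_first (- 1 - i) Tt Tr).
by rewrite zalt_sym// (_ : -1 - (-1 - i) = i)%Z//; lia.
Qed.

Section Orderings.
Variables (lt : W -> W -> Prop).
Hypothesis hlt : reflection_ordering S lt.

Lemma lt_irr a : T a -> ~ lt a a. Proof. by case: hlt => [[h _ _] _]; exact: h. Qed.

Lemma lt_tr b a c : T a -> T b -> T c -> lt a b -> lt b c -> lt a c.
Proof. by case: hlt => [[_ h _] _]; exact: h. Qed.

Lemma lt_asym a b : T a -> T b -> lt a b -> ~ lt b a.
Proof. by move=> Ta Tb ab ba; apply: (lt_irr Ta); exact: lt_tr ba. Qed.

Lemma lt_total a b : T a -> T b -> [\/ lt a b, a = b | lt b a].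
Proof. by case: hlt => [[_ _ h] _]; exact: h. Qed.

Lemma lt_nlt a b : T a -> T b -> a <> b -> ~ lt a b -> lt b a.
Proof. by move=> Ta Tb ab nab; have [] := lt_total Ta Tb. Qed.

Lemma ordering_dihedral (H : set W) r t : reflection_subgroup S H -> r <> t ->
  canonical_generators S H = [set r; t] -> dihedral_sorted lt r t \/ dihedral_sorted lt t r.
Proof.
move=> RH rt CH; have Tx x : [set r; t] x -> T x by rewrite -CH => /canonicalP[].
have Tr : T r by apply: Tx; left.
have Tt : T t by apply: Tx; right.
have [_ /(_ H r t RH rt CH)[|]] := hlt; first by left.
by move=> /(dihedral_sorted_sym lt (refl_sq Tr) (refl_sq Tt)); right.
Qed.

Lemma flip_ordering : reflection_ordering S (flip_lt lt).
Proof.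
split; last by move=> H r t RH rt CH; have [_ /(_ H r t RH rt CH)[|]] := hlt; [right|left].
split=> [a|a b c Ta Tb Tc|a b Ta Tb]; rewrite /flip_lt.
- exact: lt_irr.
- by move=> ba cb; exact: (lt_tr Tc Tb Ta).
- by have [] := lt_total Ta Tb; [apply: Or33|apply: Or32|apply: Or31].
Qed.

Lemma pair_reflection_subgroup t1 t2 : T t1 -> T t2 ->
  reflection_subgroup S (generated [set t1; t2]).
Proof. by move=> T1 T2; exists [set t1; t2] => // _ [->|->]. Qed.

(** A simple reflection in a dihedral reflection subgroup is one of its canonical
   generators, hence one end of the ordering. *)
Lemma simple_extremal s t : S s -> T t -> t <> s ->
  (forall h, T h -> generated [set s; t] h -> h = s \/ lt s h) \/
  (forall h, T h -> generated [set s; t] h -> h = s \/ lt h s).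
Proof.
move=> Ss Tt /nesym st; have Ts := simple_refl Ss.
have [a [b [Ta Tb ab CH refls]]] := dihedral_structure Ts Tt st.
have RH := pair_reflection_subgroup Ts Tt.
have : [set a; b] s.
  by rewrite -CH; apply: canonical_simple => //; apply: sub_generated; left.
have [sab|sba] := ordering_dihedral RH ab CH; case=> e.
- by left=> h Th Hh; have [i ->] := refls h Th Hh; rewrite e; exact: dihedral_first.
- by right=> h Th Hh; have [i ->] := refls h Th Hh; rewrite e; exact: dihedral_last.
- right=> h Th Hh; have [i ->] := refls h Th Hh.
  by rewrite e (zalt_sym (refl_sq Tb) (refl_sq Ta)); exact: dihedral_last.
- left=> h Th Hh; have [i ->] := refls h Th Hh.
  by rewrite e (zalt_sym (refl_sq Tb) (refl_sq Ta)); exact: dihedral_first.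
Qed.

Lemma section_stable s t : S s -> T t -> lt t s -> lt (t ^ s) s.
Proof.
move=> Ss Tt ts; have Ts := simple_refl Ss.
have tNs : t <> s by move=> e; move: ts; rewrite e; exact: lt_irr.
have tsNs : t ^ s <> s by move=> e; apply: tNs; rewrite -[t](conjKs _ Ss) e conj_by_self.
have Hs : generated [set s; t] s by apply: sub_generated; left.
have Ht : generated [set s; t] t by apply: sub_generated; right.
have Hts := subgroup_conj (generated_subgroup _) Ht Hs.
have [h|h] := simple_extremal Ss Tt tNs; have Tts := refl_conj s Tt.
  by have [//|/(lt_asym Ts Tt)] := h t Tt Ht.
by have [] := h _ Tts Hts.
Qed.

Lemma section_stableU s t : S s -> T t -> lt s t -> lt s (t ^ s).
Proof.
move=> Ss Tt st; have Ts := simple_refl Ss; have Tts := refl_conj s Tt.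
apply: lt_nlt => //.
  move=> e; have ts : t = s by rewrite -[t](conjKs _ Ss) e conj_by_self.
  by move: st; rewrite ts; exact: lt_irr.
by move=> /(section_stable Ss Tts); rewrite conjKs//; exact: lt_asym.
Qed.

(** The lower conjugate of an ordering: nothing changes below [s], the part above
   [s] is conjugated by [s], and [s] moves to the last place. *)
Definition conj_lt (s a b : W) : Prop :=
  (lt a s /\ (lt b s -> lt a b)) \/
  [/\ ~ lt a s, a <> s, ~ lt b s & b = s \/ lt (a ^ s) (b ^ s)].

Section ConjOrdering.
Variable s : W.
Hypothesis Ss : S s.
Let Ts := simple_refl Ss.

Lemma conj_lt_order : strict_total_order_on T (conj_lt s).
Proof.
split=> [a Ta|a b c Ta Tb Tc|a b Ta Tb].
- case=> [[h /(_ h)]|[_ nas _ [//|]]]; first exact: lt_irr.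
  exact/lt_irr/refl_conj.
- case=> [[la lab]|[na as' nb lab]]; case=> [[lb lbc]|[nb' bs nc lbc]] //.
  + by left; split=> // lc; apply: (lt_tr Ta Tb Tc); [exact: lab|exact: lbc].
  + by left; split=> // /nc.
  + right; split=> //; case: lbc => [|lbc]; first by left.
    case: lab => [//|lab]; right.
    exact: (lt_tr (refl_conj s Ta) (refl_conj s Tb) (refl_conj s Tc)).
- have [la|na] := pselect (lt a s); have [lb|nb] := pselect (lt b s).
  + by have [h|h|h] := lt_total Ta Tb; [apply: Or31; left|apply: Or32|apply: Or33; left].
  + by apply: Or31; left.
  + by apply: Or33; left.
  have [as'|as'] := pselect (a = s); have [bs|bs] := pselect (b = s).
  + by apply: Or32; rewrite as' bs.
  + by apply: Or33; right; split=> //; left.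
  + by apply: Or31; right; split=> //; left.
  have [h|h|h] := lt_total (refl_conj s Ta) (refl_conj s Tb).
  + by apply: Or31; right; split=> //; right.
  + by apply: Or32; rewrite -[a](conjKs _ Ss) h conjKs.
  + by apply: Or33; right; split=> //; right.
Qed.

Lemma conj_lt_above a b : T a -> T b -> lt s a -> lt s b -> lt (a ^ s) (b ^ s) -> conj_lt s a b.
Proof.
move=> Ta Tb la lb h; right; split; [exact: lt_asym| |exact: lt_asym|by right].
by move=> e; move: la; rewrite e; exact: lt_irr.
Qed.

Lemma conj_lt_both a b : T a -> T b -> a <> s -> lt a b -> lt (a ^ s) (b ^ s) -> conj_lt s a b.
Proof.
move=> Ta Tb as' ab h; have [la|na] := pselect (lt a s); first by left.
right; split=> //; last by right.
by move=> lb; apply: na; exact: (lt_tr Ta Tb Ts).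
Qed.

(** All other reflections lie on one side of [s]. If it is the side above, the
   conjugation exchanges the two directions of the sequence, which agrees with
   the move of [s] from the first to the last place. *)
Lemma conj_dihedral_simple t : T t -> dihedral_sorted lt s t \/ dihedral_sorted lt t s ->
  dihedral_sorted (conj_lt s) t s.
Proof.
move=> Tt; have ss := refl_sq Ts; have tt := refl_sq Tt.
have [m o] := ord_exists (s * t); have o' := ord_sym ss tt o.
move=> sorted; apply/(dihedral_sortedP _ tt ss o') => i j ij.
case: sorted => sorted; last first.
  have bel k : zalt t s k = s \/ lt (zalt t s k) s by exact: dihedral_last.
  have Ti := refl_zalt i Tt Ts; have Tj := refl_zalt j Tt Ts.
  have lij : lt (zalt t s i) (zalt t s j) by exact: ((dihedral_sortedP lt tt ss o').1 sorted).
  left; split=> //; case: (bel i) => // e; move: lij; rewrite e in Ti *.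
  by case: (bel j) => [->|/(lt_asym Tj Ts)//] /lt_irr; case.
have abo k : zalt s t k = s \/ lt s (zalt s t k) by exact: dihedral_first.
have nabo k : ~ lt (zalt s t k) s.
  have Tk := refl_zalt k Ts Tt.
  by case: (abo k) => [->|/(lt_asym Ts Tk)//]; exact: lt_irr.
have J k : zalt s t k ^ s = zalt s t (- k).
  by rewrite -{2}(zalt0 s t) zalt_conj_zalt//.
rewrite !(zalt_sym ss tt); right; split=> //.
  rewrite -[X in _ <> X](zalt0 s t) => /(zalt_eq ss tt _ _ o)[k kE].
  move: ij; rewrite /before; case: eqP kE => [-> kE|m0 kE ij]; first by case; lia.
  have [h|[h|h]] : (k = 0 \/ k <= -1 \/ 1 <= k)%Z by lia.
  - by rewrite h in kE; lia.
  - nia.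
  - nia.
rewrite !J; have [mj|nmj] := pselect (Z.of_nat m | j + 1)%Z.
  left; rewrite -[RHS](zalt0 s t); apply/(zalt_eq ss tt _ _ o).
  by have [k kE] := mj; exists (- k)%Z; lia.
right; apply: ((dihedral_sortedP lt ss tt o).1 sorted).
move: ij; rewrite /before; case: eqP => m0.
  have j1 : (j + 1 <> 0)%Z by move=> e; apply: nmj; exists 0%Z; lia.
  by case=> h; [apply: Or31|apply: Or32|apply: Or33]; lia.
have : (j + 1 <> Z.of_nat m)%Z by move=> e; apply: nmj; exists 1%Z; lia.
lia.
Qed.

(** On each of the two sides of [s] the new order is a dihedral order. If both sides
   occur, then [r] is below and [t] above [s], hence the same holds for their
   conjugates, and the two dihedral orders have the same direction. *)
Lemma conj_dihedral_avoiding r t : T r -> T t -> r <> t ->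
  (forall i, zalt r t i <> s) ->
  dihedral_sorted lt r t -> dihedral_sorted lt (r ^ s) (t ^ s) \/ dihedral_sorted lt (t ^ s) (r ^ s) ->
  dihedral_sorted (conj_lt s) r t \/ dihedral_sorted (conj_lt s) t r.
Proof.
move=> Tr Tt rt ns srt srts; have rr := refl_sq Tr; have tt := refl_sq Tt.
have [m o] := ord_exists (r * t).
have Trs := refl_conj s Tr; have Tts := refl_conj s Tt.
have Tz i := refl_zalt i Tr Tt.
have rs : r <> s by have := ns 0%Z; rewrite zalt0.
have ts : t <> s by have := ns (-1)%Z; rewrite zaltm1.
have lz i j : before m i j -> lt (zalt r t i) (zalt r t j).
  exact: ((dihedral_sortedP _ rr tt o).1 srt).
have [tL|tU] := pselect (lt t s).
  left; apply/(dihedral_sortedP _ rr tt o) => i j ij; left; split=> [|_]; last exact: lz.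
  have [->//|it] := dihedral_last i Tr Tt srt; exact: (lt_tr (Tz i) Tt Ts).
have [rL|rU] := pselect (lt r s); last first.
  have abo i : lt s (zalt r t i).
    have sr : lt s r by apply: lt_nlt.
    have [->//|ri] := dihedral_first i Tr Tt srt; exact: (lt_tr Ts Tr (Tz i)).
  have abo' i : lt s (zalt t r i) by rewrite zalt_sym.
  have Tz' i := refl_zalt i Tt Tr.
  have o' := ord_sym rr tt o.
  case: srts => h; [left; apply/(dihedral_sortedP _ rr tt o)|right; apply/(dihedral_sortedP _ tt rr o')] => i j ij;
    apply: conj_lt_above => //; rewrite -!zalt_conj.
  - exact: ((dihedral_sortedP lt (refl_sq Trs) (refl_sq Tts) (ord_conj s o)).1 h).
  - exact: ((dihedral_sortedP lt (refl_sq Tts) (refl_sq Trs) (ord_conj s o')).1 h).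
have st : lt s t by apply: lt_nlt.
have rts : lt (r ^ s) (t ^ s).
  apply: (lt_tr Trs Ts Tts); first exact: section_stable.
  exact: section_stableU.
case: srts => h; last first.
  have := dihedral_last 0 Tts Trs h; rewrite zalt0 => -[e|].
    by case: (lt_irr Trs); rewrite -{2}e.
  by move=> /(lt_asym Tts Trs).
left; apply/(dihedral_sortedP _ rr tt o) => i j ij; apply: conj_lt_both => //; first exact: lz.
rewrite -!zalt_conj.
exact: ((dihedral_sortedP lt (refl_sq Trs) (refl_sq Tts) (ord_conj s o)).1 h).
Qed.

Lemma conj_reflection_subgroup H : reflection_subgroup S H -> reflection_subgroup S (conj_set H s).
Proof.
move=> [A AT ->]; exists (conj_set A s) => [a /AT /(refl_conj s)|]; first by rewrite conjKs.
apply/seteqP; split.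
  move=> h; rewrite /conj_set /= => Ah.
  suff : generated A `<=` conj_set (generated (conj_set A s)) s.
    by move=> /(_ _ Ah); rewrite /conj_set /= conjKs.
  apply: generated_min; first exact/conj_subgroup/generated_subgroup.
  by move=> a Aa; apply: sub_generated; rewrite /conj_set /= conjKs.
apply: generated_min; first exact/conj_subgroup/generated_subgroup.
by move=> a Aa; exact: sub_generated.
Qed.

Theorem conj_ordering : reflection_ordering S (conj_lt s).
Proof.
split; first exact: conj_lt_order.
move=> H r t RH rt CH.
have Hg : is_subgroup H by case: RH => A _ ->; exact: generated_subgroup.
have C x : [set r; t] x -> T x /\ H x by rewrite -CH => /canonicalP[].
have [Tr Hr] : T r /\ H r by apply: C; left.
have [Tt Ht] : T t /\ H t by apply: C; right.
have rr := refl_sq Tr; have tt := refl_sq Tt.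
have srt := ordering_dihedral RH rt CH.
rewrite (dihedral_sorted_sym (conj_lt s) rr tt).
have [Hs|nHs] := pselect (H s).
  have : [set r; t] s by rewrite -CH; exact: canonical_simple.
  case=> e; rewrite -e in Tr Tt srt *; [right|left]; apply: conj_dihedral_simple => //.
  by case: srt; [right|left].
have Hz i : H (zalt r t i).
  have : generated [set r; t] (zalt r t i) by exact: generated_zalt.
  by apply: generated_min => // _ [->|->].
have ns i : zalt r t i <> s by move=> e; apply: nHs; rewrite -e.
have CHs : canonical_generators S (conj_set H s) = [set r ^ s; t ^ s].
  apply/seteqP; split=> x.
    move=> /(canonical_conj _ Hg Ss nHs); rewrite CH => -[] /= e; [left|right];
    by rewrite /= -e conjKs.
  by case=> ->; apply/(canonical_conj _ Hg Ss nHs); rewrite conjKs// CH; [left|right].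
have rts : r ^ s <> t ^ s by move=> /conjg_inj.
have srts := ordering_dihedral (conj_reflection_subgroup RH) rts CHs.
case: srt => srt; first exact: conj_dihedral_avoiding.
have ns' i : zalt t r i <> s by rewrite zalt_sym.
have srts' : dihedral_sorted lt (t ^ s) (r ^ s) \/ dihedral_sorted lt (r ^ s) (t ^ s).
  by case: srts; [right|left].
by have [] := conj_dihedral_avoiding Tt Tr (nesym rt) ns' srt srts'; [right|left].
Qed.

End ConjOrdering.
End Orderings.
(** * Increasing saturated chains *)

(** All pairs are compared, not only neighbours, since an ordering is transitive
   only on reflections. *)
Fixpoint inc (lt : W -> W -> Prop) (l : seq W) : Prop :=
  if l is t :: l' then {in l', forall r, lt t r} /\ inc lt l' else True.

Lemma inc_cat lt k l : inc lt (k ++ l) <->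
  [/\ inc lt k, inc lt l & {in k & l, forall a b, lt a b}].
Proof.
elim: k => [|t k IH] /=; first by split=> [h|[]//]; split=> // a b.
rewrite IH; split=> [[h [ik il kl]]|[[h ik] il kl]].
  split=> //; first by split=> // r rk; apply: h; rewrite mem_cat rk.
  move=> a b; rewrite inE => /orP[/eqP->|ak] bl; last exact: kl.
  by apply: h; rewrite mem_cat bl orbT.
split; last by split=> // a b ak bl; apply: kl => //; rewrite inE ak orbT.
move=> r; rewrite mem_cat => /orP[/h//|rl]; apply: kl => //.
exact: mem_head.
Qed.

Lemma inc_sub lt lt' l : {in l &, forall a b, lt a b -> lt' a b} -> inc lt l -> inc lt' l.
Proof.
elim: l => [|t l IH] //= sub [h il]; split.
  move=> r rl; apply: sub; rewrite ?inE ?eqxx ?rl ?orbT//; exact: h.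
by apply: IH => // a b al bl; apply: sub; rewrite inE (al, bl) orbT.
Qed.

Lemma inc_map lt (f : W -> W) l : inc lt (map f l) <-> inc (fun a b => lt (f a) (f b)) l.
Proof.
elim: l => [|t l IH] //=; rewrite IH; split=> -[h il]; split=> // r.
  by move=> rl; apply: h; exact: map_f.
by move=> /mapP[a al ->]; exact: h.
Qed.

Definition inc_chain lt u l v := [/\ sat u l, inc lt l & endpt u l = v].

Lemma sat_refl u l : sat u l -> {in l, forall t, T t}.
Proof. by case=> /up_path_refl. Qed.

Lemma inc_chain_len lt u l v : inc_chain lt u l v -> len v = (len u + size l)%N.
Proof. by move=> [[_ e] _ <-]. Qed.

Lemma inc_chain_le lt u l v : inc_chain lt u l v -> u <=b v.
Proof. by move=> [/sat_le + _ <-]. Qed.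

Section AscentCase.
Variables (lt : W -> W -> Prop) (hlt : reflection_ordering S lt).
Variables (s u v : W).
Hypotheses (Ss : S s) (us : ~~ dn u s) (vs : dn v s).

Let Ts : T s := simple_refl Ss.

(** A chain without label [s] would stay ascending after translation by [s], but
   the distance from [u * s] to [v * s] is shorter by two than its number of
   steps. After the label [s], translation by [s] preserves the chain. *)
Lemma conj_chain_down l : inc_chain lt u l v -> exists l1 l2,
  [/\ l = l1 ++ s :: l2, {in l1, forall t, lt t s}, {in l2, forall t, lt s t} &
      inc_chain (conj_lt lt s) u (l1 ++ [seq t ^ s | t <- l2]) (v * s)].
Proof.
move=> [[ul lE] il ev].
have lvs : len (v * s) = (len v).-1 by rewrite len_simpleMr// vs.
have v0 := len_gt0_dn Ss vs.
have sl : s \in l.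
  apply/negPn/negP => nsl; have [h1 h2] := up_path_conj Ss ul nsl.
  have := up_path_len h1; rewrite h2 ev lvs size_map len_simpleMr// (negPf us).
  by move=> /= h; rewrite ev in lE; lia.
case/splitPr: sl ul lE il ev => l1 l2 ul lE.
move=> /inc_cat[il1 [sl2 il2] cross] ev.
have L1 : {in l1, forall t, lt t s} by move=> t tl; apply: cross => //; exact: mem_head.
exists l1, l2; split=> //.
have /sat_cat[sat1 /sat_cons[_ las sat2]] : sat u (l1 ++ s :: l2) by [].
rewrite endpt_cat endpt_cons in ev; set a := endpt u l1 in las sat2 ev.
have nsl2 : s \notin l2 by apply/negP => /sl2; exact: lt_irr.
have [h1 h2] := up_path_conj Ss sat2.1 nsl2; rewrite mulss// ev in h1 h2.
have le2 := sat2.2; rewrite ev las in le2.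
have T1 := sat_refl sat1; have T2 := sat_refl sat2.
split; last by rewrite endpt_cat.
  apply/sat_cat; split=> //; split=> //; rewrite h2 size_map lvs le2 -/a.
  by rewrite addSn.
apply/inc_cat; split.
- by apply: inc_sub il1 => b c /L1 lb /L1 lc bc; left.
- apply/inc_map; apply: inc_sub il2 => b c bl cl bc.
  apply: (conj_lt_above hlt) => //; try exact/refl_conj/T2.
  + by apply: (section_stableU hlt) => //; [exact: T2|exact: sl2].
  + by apply: (section_stableU hlt) => //; [exact: T2|exact: sl2].
  + by rewrite !conjKs.
- move=> b _ bl /mapP[c cl ->]; left; split=> [|h]; first exact: L1.
  case: (lt_asym hlt Ts (refl_conj s (T2 _ cl))) => //.
  by apply: (section_stableU hlt) => //; [exact: T2|exact: sl2].
Qed.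

Lemma conj_inc_split l : {in l, forall t, T t} -> s \notin l -> inc (conj_lt lt s) l ->
  exists l1 l2, [/\ l = l1 ++ l2, {in l1, forall t, lt t s} & {in l2, forall t, lt s t}].
Proof.
elim: l => [|t l IH] Tl; first by exists [::], [::].
rewrite inE negb_or eq_sym => /andP[ts sl] [tl il].
have Tt : T t by apply: Tl; exact: mem_head.
have Tl' : {in l, forall t, T t} by move=> r rl; apply: Tl; rewrite inE rl orbT.
have [l1 [l2 [e h1 h2]]] := IH Tl' sl il.
have [lts|nts] := pselect (lt t s).
  exists (t :: l1), l2; split=> //; first by rewrite e.
  by move=> r; rewrite inE => /orP[/eqP->|/h1].
exists [::], (t :: l); split=> // r; rewrite inE => /orP[/eqP->|rl].
  by apply: (lt_nlt hlt) => //; exact/eqP.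
apply: (lt_nlt hlt) => //; first exact: Tl'.
  by move=> e'; move: rl; rewrite e' (negPf sl).
by have [[]//|[]] := tl r rl.
Qed.

(** [s] cannot occur in the given chain, where it would be the last label. The
   part below [s] ends at an element with ascent [s] by a count of lengths, so
   the label [s] can be inserted there. *)
Lemma conj_chain_up l : inc_chain (conj_lt lt s) u l (v * s) -> exists l1 l2,
  [/\ l = l1 ++ l2, {in l1, forall t, lt t s}, {in l2, forall t, lt s t} &
      inc_chain lt u (l1 ++ s :: [seq t ^ s | t <- l2]) v].
Proof.
move=> [sl il ev].
have lvs : len (v * s) = (len v).-1 by rewrite len_simpleMr// vs.
have v0 := len_gt0_dn Ss vs.
have Tl := sat_refl sl.
have nsl : s \notin l.
  apply/negP => sinl; case/splitPr: sinl Tl sl il ev => l1 l2 Tl sl.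
  move=> /inc_cat[_ [h _] _]; case: l2 h => [h|t l2 h] in Tl sl *; last first.
    by case: (h t (mem_head _ _)) => -[] => [/(lt_irr hlt Ts)|_ /(_ erefl)].
  rewrite endpt_cat endpt_cons endpt_nil => ev; move: sl => /sat_cat[_ /sat_cons[_ las _]].
  by move: las; rewrite ev lvs (@mulIg _ s _ _ ev); lia.
have [l1 [l2 [e L1 U2]]] := conj_inc_split Tl nsl il.
exists l1, l2; split=> //; subst l.
have /sat_cat[sat1 sat2] := sl.
have [nsl1 nsl2] : s \notin l1 /\ s \notin l2.
  by move: nsl; rewrite mem_cat negb_or => /andP.
rewrite endpt_cat in ev; set a := endpt u l1 in sat2 ev.
have aS : ~~ dn a s.
  apply/negP => das; have [h1 h2] := up_path_conj Ss sat1.1 nsl1.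
  have := up_path_len h1; rewrite h2 -/a (len_simpleMr u Ss) (len_simpleMr a Ss) das (negPf us) size_map.
  by have := sat1.2; rewrite -/a /=; lia.
have [h1 h2] := up_path_conj Ss sat2.1 nsl2; rewrite ev mulss// in h1 h2.
have las : len (a * s) = (len a).+1 by rewrite len_simpleMr// (negPf aS).
have T2 := sat_refl sat2.
split; last by rewrite endpt_cat endpt_cons.
  apply/sat_cat; split=> //; apply/sat_cons; split=> //; split=> //.
  have := sat2.2; rewrite h2 size_map ev lvs las addSn => <-; rewrite prednK//.
have Uc : {in [seq t ^ s | t <- l2], forall t, lt s t}.
  by move=> _ /mapP[c cl ->]; apply: (section_stableU hlt) => //; [exact: T2|exact: U2].
move/inc_cat: il => [il1 il2 _]; apply/inc_cat; split.
- apply: inc_sub il1 => b c /L1 lb /L1 lc [[_ h]|[nb _ _ _]]; first exact: h.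
  by case: nb.
- split=> //; apply/inc_map; apply: inc_sub il2 => b c bl cl.
  case=> [[lb _]|[_ _ _ [cs|//]]].
    by case: (lt_asym hlt Ts (T2 _ bl) (U2 _ bl)).
  by have := U2 _ cl; rewrite cs => /(lt_irr hlt Ts).
- move=> b c bl; rewrite inE => /orP[/eqP->|cl]; first exact: L1.
  apply: (lt_tr hlt _ Ts _ (L1 _ bl) (Uc _ cl)); first exact: (sat_refl sat1).
  by move: cl => /mapP[d dl ->]; exact/refl_conj/T2.
Qed.

Lemma cat_sections (k1 k2 l1 l2 : seq W) :
  {in k1, forall t, lt t s} -> {in l1, forall t, lt t s} ->
  {in k2, forall t, T t /\ lt s t} -> {in l2, forall t, T t /\ lt s t} ->
  k1 ++ k2 = l1 ++ l2 -> k1 = l1 /\ k2 = l2.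
Proof.
move=> K1 L1 K2 L2 e.
have F l : {in l, forall t, lt t s} -> [seq t <- l | `[< lt t s >]] = l.
  by move=> h; apply/all_filterP/allP => t /h lts; apply/asboolP.
have F' l : {in l, forall t, T t /\ lt s t} -> [seq t <- l | `[< lt t s >]] = [::].
  move=> h; apply/eqP; rewrite -size_eq0 size_filter eqn0Ngt -has_count; apply/hasPn => t /h[Tt st].
  by apply/asboolPn; exact: (lt_asym hlt).
have e1 : k1 = l1.
  have := congr1 (filter (fun t => `[< lt t s >])) e.
  by rewrite !filter_cat (F _ K1) (F _ L1) (F' _ K2) (F' _ L2) !cats0.
by split=> //; move: e; rewrite e1 => /eqP; rewrite eqseq_cat// eqxx => /eqP.
Qed.

Lemma ascent_unique :
  (exists! l, inc_chain (conj_lt lt s) u l (v * s)) -> exists! l, inc_chain lt u l v.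
Proof.
move=> [l [/conj_chain_up[l1 [l2 [_ _ _ h]]] uniq]].
exists (l1 ++ s :: [seq t ^ s | t <- l2]); split=> // k hk.
have down k' : inc_chain lt u k' v -> exists k1 k2, [/\ k' = k1 ++ s :: k2,
   l = k1 ++ [seq t ^ s | t <- k2], {in k1, forall t, lt t s} &
   {in [seq t ^ s | t <- k2], forall t, T t /\ lt s t}].
  move=> hk'; have [k1 [k2 [e K1 K2 /uniq hk2]]] := conj_chain_down hk'.
  exists k1, k2; split=> // _ /mapP[t tk ->].
  have Tt : T t.
    by have [/sat_refl h' _ _] := hk'; apply: h'; rewrite e mem_cat inE tk !orbT.
  by split; [exact: refl_conj|apply: (section_stableU hlt) => //; exact: K2].
have [k1 [k2 [-> e1 K1 K2]]] := down _ h.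
have [m1 [m2 [-> e2 M1 M2]]] := down _ hk.
have [-> e] := cat_sections K1 M1 K2 M2 (etrans (esym e1) e2).
by rewrite (inj_map (@conjg_inj _ s) e).
Qed.

End AscentCase.
Lemma inc_rev lt l : inc (flip_lt lt) (rev l) <-> inc lt l.
Proof.
elim: l => [|t l IH] //=; rewrite rev_cons -cats1.
split=> [/inc_cat[/IH h1 _ h2]|[h1 /IH h2]].
  by split=> // r rl; apply: h2; rewrite ?mem_rev// mem_head.
apply/inc_cat; split=> //.
by move=> a b; rewrite mem_rev inE => al /eqP->; exact: h1.
Qed.

Section DescentCase.
Variables (lt : W -> W -> Prop) (hlt : reflection_ordering S lt).
Variables (s u0 v : W).
Hypotheses (Ss : S s) (us : ~~ dn u0 s) (vs : dn v s) (u0v : u0 <=b v).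

(** A pair [(e, c)] stands for the word [rev e ++ c], decreasing along [rev e] and
   then increasing along [c]; with [e] reversed, the two labels that meet at the
   bottom are the two heads. *)
Definition valley (x : seq W * seq W) : Prop :=
  [/\ inc lt x.1, inc lt x.2, sat u0 (rev x.1 ++ x.2) & endpt u0 (rev x.1 ++ x.2) = v].

Definition bottom (x : seq W * seq W) : W := endpt u0 (rev x.1).

(** The word is unchanged; the smaller of the two heads moves to the other side. *)
Definition toggle (x : seq W * seq W) : seq W * seq W :=
  match x with
  | ([::], [::]) => x
  | ([::], b :: c) => ([:: b], c)
  | (a :: e, [::]) => (e, [:: a])
  | (a :: e, b :: c) => if `[< lt a b >] then (e, [:: a, b & c]) else ([:: b, a & e], c)
  end.

Lemma toggle_word x : rev (toggle x).1 ++ (toggle x).2 = rev x.1 ++ x.2.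
Proof.
case: x => [[|a e] [|b c]] //=; first by rewrite cats0 rev_cons cats1.
by case: asboolP => _ /=; rewrite !rev_cons !cat_rcons.
Qed.

Lemma valley_heads a b e c : valley (a :: e, b :: c) -> [/\ T a, T b & a <> b].
Proof.
move=> [_ _ + _]; rewrite /= rev_cons cat_rcons => /sat_cat[_ /sat_cons[Ta la /sat_cons[Tb lb _]]].
split=> // ab; move: lb; rewrite -ab -mulgA refl_sq// mulg1 la; lia.
Qed.

Lemma valley_refl x : valley x -> {in x.1, forall t, T t} /\ {in x.2, forall t, T t}.
Proof.
move=> [_ _ /sat_refl h _]; split=> t tx; apply: h; rewrite mem_cat.
  by rewrite mem_rev tx.
by rewrite tx orbT.
Qed.

Lemma toggle_valley x : valley x -> valley (toggle x).
Proof.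
move=> vx; have [T1 T2] := valley_refl vx; have [i1 i2 sx ex] := vx.
split; rewrite ?toggle_word//; case: x => [[|a e] [|b c]] /= in vx T1 T2 i1 i2 {sx ex} *;
  [by []|by split|by case: i1| |by []|by case: i2|by split|];
  have [Ta Tb ab] := valley_heads vx; case: asboolP => ltab /=.
- by case: i1.
- have ba : lt b a by exact: (lt_nlt hlt).
  split=> // r; rewrite inE => /orP[/eqP->//|re].
  apply: (lt_tr hlt Tb Ta _ ba); first by apply: T1; rewrite inE re orbT.
  exact: i1.1.
- split=> // r; rewrite inE => /orP[/eqP->//|rc].
  apply: (lt_tr hlt Ta Tb _ ltab); first by apply: T2; rewrite inE rc orbT.
  exact: i2.1.
- by case: i2.
Qed.

Lemma toggleK x : valley x -> toggle (toggle x) = x.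
Proof.
move=> vx; have [T1 T2] := valley_refl vx; have [i1 i2 _ _] := vx.
case: x => [[|a e] [|b c]] /= in vx T1 T2 i1 i2 *.
- by [].
- case: c => [|d c] //= in vx T2 i2 *; case: asboolP => //; case.
  by apply: i2.1; exact: mem_head.
- case: e => [|d e] //= in vx T1 i1 *; case: asboolP => // da.
  have ad : lt a d by apply: i1.1; exact: mem_head.
  by case: (lt_asym hlt _ _ ad da); apply: T1; rewrite !inE eqxx ?orbT.
have [Ta Tb ab] := valley_heads vx; case: asboolP => ltab /=.
  case: e => [|d e] //= in vx T1 i1 *; case: asboolP => // da.
  have ad : lt a d by apply: i1.1; exact: mem_head.
  by case: (lt_asym hlt _ _ ad da); apply: T1; rewrite !inE eqxx ?orbT.
case: c => [|d c] //= in vx T2 i2 *; case: asboolP => //; case.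
by apply: i2.1; exact: mem_head.
Qed.

Lemma bottom_range x : valley x -> [/\ u0 <=b bottom x, bottom x <=b v &
  len (bottom x) = (len u0 + size x.1)%N].
Proof.
move=> [_ _ /sat_cat[s1 s2] ev]; split; first exact: sat_le.
  by rewrite -ev endpt_cat; exact: sat_le.
by rewrite /bottom s1.2 size_rev.
Qed.

Lemma toggle_parity x : valley x -> odd (size (toggle x).1) = ~~ odd (size x.1).
Proof.
move=> [_ _ sx ev].
have : (0 < size (rev x.1 ++ x.2))%N.
  have := sx.2; rewrite ev; case: (eqVneq u0 v) => [uv|uv].
    by move: us; rewrite uv vs.
  have [h1 h2] := bruhat_len u0v; have : len u0 <> len v by move=> /h2/eqP; rewrite (negPf uv).
  lia.
case: x {sx ev} => [[|a e] [|b c]] //= _; rewrite ?negbK//.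
by case: asboolP => _ /=; rewrite ?negbK.
Qed.

Lemma valley_bottomP x z : valley x /\ bottom x = z <->
  inc_chain (flip_lt lt) u0 (rev x.1) z /\ inc_chain lt z x.2 v.
Proof.
split.
  move=> [[i1 i2 /sat_cat[s1 s2] ev] <-]; rewrite endpt_cat in ev.
  by split; split=> //; exact/inc_rev.
move=> [[s1 /inc_rev i1 e1] [s2 i2 e2]]; split=> //; split=> //.
  by apply/sat_cat; rewrite e1.
by rewrite endpt_cat e1.
Qed.

(** Multiplication by [s] pairs the elements [z] of the interval from [u0] to [v]
   with opposite parity, and so does [toggle] for the valleys, one over each [z]
   except possibly over [u0 * s]. *)
Lemma descent_unique :
  (forall z, u0 <=b z -> z <=b v -> z <> u0 * s -> exists! l, inc_chain lt z l v) ->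
  (forall z, u0 <=b z -> z <=b v -> exists! l, inc_chain (flip_lt lt) u0 l z) ->
  exists! l, inc_chain lt (u0 * s) l v.
Proof.
move=> incU decU; have [l ul lP] := lower_finite v.
pose Z := [seq z <- l | `[< u0 <=b z >]].
have ZP z : z \in Z <-> u0 <=b z /\ z <=b v.
  rewrite mem_filter; split=> [/andP[/asboolP h /lP]//|[h1 /lP h2]].
  by rewrite h2 andbT; exact/asboolP.
have Zs z : z \in Z -> z * s \in Z.
  move=> /ZP[uz zv]; apply/ZP; split; last exact: lift_up.
  case: (boolP (dn z s)) => dz; first exact: lift_le.
  by apply: bruhat_trans uz _; apply: bruhat_up => //; exact: simple_refl.
(* parity relative to [u0], so that [u0 * s] is on the odd side *)
pose par z := odd (len z) == odd (len u0).
have parE z : par (z * s) = ~~ par z.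
  have := odd_len_refl (simple_refl Ss); rewrite /par odd_lenM => ->.
  by case: (odd (len z)); case: (odd _).
pose E := [seq z <- Z | par z]; pose O := [seq z <- Z | ~~ par z].
have uZ : uniq Z by exact: filter_uniq.
have sinj : injective (fun z => z * s) by exact: mulIg.
have size_le (p q : pred W) : (forall z, p z -> q (z * s)) ->
    (size [seq z <- Z | p z] <= size [seq z <- Z | q z])%N.
  move=> pq; rewrite -(size_map (fun z => z * s)); apply: uniq_leq_size.
    by rewrite map_inj_uniq ?filter_uniq.
  by move=> _ /mapP[z + ->]; rewrite mem_filter => /andP[pz zZ]; rewrite mem_filter pq//; exact: Zs.
have EO : size E = size O.
  by apply/eqP; rewrite eqn_leq !size_le// => z; rewrite parE ?negbK.
have uinO : u0 * s \in O.
  rewrite mem_filter parE /par eqxx /=; apply: Zs; apply/ZP; split=> //.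
  exact: bruhat_refl.
have fib z : (exists! k, inc_chain (flip_lt lt) u0 k z) -> (exists! k, inc_chain lt z k v) ->
    exists! x, valley x /\ bottom x = z.
  move=> [d [hd dU]] [c [hc cU]]; exists (rev d, c); split.
    by apply/valley_bottomP; rewrite /= revK.
  by move=> [d' c'] /valley_bottomP[/dU -> /cU ->]; rewrite revK.
have inZ x : valley x -> bottom x \in Z.
  by move=> /bottom_range[h1 h2 _]; apply/ZP.
have flip_par x : valley x -> par (bottom (toggle x)) = ~~ par (bottom x).
  move=> vx; have [_ _ h1] := bottom_range vx; have [_ _ h2] := bottom_range (toggle_valley vx).
  rewrite /par h1 h2 !oddD toggle_parity//.
  by move: (odd (len u0)) (odd (size x.1)) => [] [].
have [||||||[d c] [/valley_bottomP[/= hd hc] cU]] := @toggle_count _ _ E O (u0 * s) valley bottom toggle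
    (filter_uniq _ uZ) (filter_uniq _ uZ) EO uinO.
- move=> z; rewrite mem_filter => /andP[zp /ZP[h1 h2]]; apply: fib; first exact: decU.
  by apply: incU => // zE; move: zp; rewrite zE parE /par eqxx.
- move=> z; rewrite mem_filter => /andP[_ /ZP[h1 h2]] /eqP zu; apply: fib; first exact: decU.
  exact: incU.
- exact: toggle_valley.
- exact: toggleK.
- by move=> x vx; rewrite mem_filter => /andP[px _]; rewrite mem_filter flip_par// negbK px inZ//; exact: toggle_valley.
- by move=> x vx; rewrite mem_filter => /andP[px _]; rewrite mem_filter flip_par// px inZ//; exact: toggle_valley.
exists c; split=> // c' hc'.
by have /cU[] : valley (d, c') /\ bottom (d, c') = u0 * s by apply/valley_bottomP.
Qed.

End DescentCase.

(** In the descent case the inner induction runs over the elements of the interval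
   from [u * s] to [v]: those with descent [s] lie above [u], those with ascent
   [s] fall under the ascent case. *)
Theorem inc_chain_unique lt u v : reflection_ordering S lt -> u <=b v ->
  exists! l, inc_chain lt u l v.
Proof.
have [n] := ubnP (len v); elim: n u v lt => // n IH u v lt vn hlt uv.
have [v1|/exists_descent[s Ss vs]] := eqVneq v 1.
  have u1 : u = 1.
    by apply: len0; have [+ _] := bruhat_len uv; rewrite v1 len1 leqn0 => /eqP.
  exists [::]; split; first by split; rewrite ?endpt_nil ?u1 ?v1//; exact: sat_nil.
  move=> [|t l] // /inc_chain_len; rewrite v1 u1 len1 /=; lia.
have v0 := len_gt0_dn Ss vs.
have lvs : (len (v * s) < n)%N by rewrite len_simpleMr// vs; lia.
have asc lt' z : reflection_ordering S lt' -> z <=b v -> ~~ dn z s ->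
    exists! l, inc_chain lt' z l v.
  move=> hlt' zv zs; apply: (ascent_unique hlt' Ss) => //.
  by apply: IH => //; [exact: conj_ordering|exact: lift_le].
have [k] := ubnP (len v - len u); elim: k u uv => // k IHk u uv uk.
have [us|us] := boolP (dn u s); last exact: asc.
have us0 : ~~ dn (u * s) s by rewrite dn_simple// us.
have usu : u * s <=b u by apply: bruhat_dn => //; exact: simple_refl.
rewrite -(mulss u Ss); apply: (descent_unique hlt Ss us0 vs (bruhat_trans usu uv)).
  move=> z uz zv; rewrite mulss// => zu.
  have [zs|] := boolP (dn z s); last exact: asc.
  apply: IHk => //; have [_ ] := bruhat_lift Ss uz.
  rewrite /pair_max (negPf us0) zs mulss// => /bruhat_len[h1 h2].
  have [h3 _] := bruhat_len zv.
  have h : len u <> len z by move=> /h2/esym.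
  lia.
move=> z uz zv; have [zv'|zv'] := ltnP (len z) (len v).
  by apply: IH => //; [lia|exact: flip_ordering].
have -> : z = v by have [h1 h2] := bruhat_len zv; apply: h2; lia.
by apply: asc => //; [exact: flip_ordering|exact: bruhat_trans uv].
Qed.
(** * Intervals of length two *)

Lemma left_edge s c t : S s -> c * t <> s * c -> dn (s * c) t = dn c t.
Proof.
move=> Ss ne; rewrite dnMs//; case: eqP => // e.
by case: ne; rewrite mulg_conjV e.
Qed.

(** Otherwise translation by [s] on the left would keep the edge ascending, though
   the lengths of its two ends change in opposite directions. *)
Lemma cover_simple s c t : S s -> T t -> len (c * t) = (len c).+1 ->
  ~~ inv c s -> inv (c * t) s -> c * t = s * c.
Proof.
move=> Ss Tt ct cs cts; apply: contrapT => ne.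
have := left_edge Ss ne; have : ~~ dn c t by rewrite -len_up// ct.
move=> /negPf -> /negbT; rewrite -len_up// -mulgA (len_simpleMl (c * t) Ss) (len_simpleMl c Ss) cts (negPf cs) ct; lia.
Qed.

Lemma sat2 u a b : sat u [:: a; b] <->
  [/\ T a, T b, len (u * a) = (len u).+1 & len (u * a * b) = (len u).+2].
Proof.
rewrite !sat_cons; split=> [[Ta la /sat_cons[Tb lb _]]|[Ta Tb la lb]].
  by split=> //; rewrite lb la.
by split=> //; apply/sat_cons; split; rewrite ?lb ?la//; exact: sat_nil.
Qed.

Definition in_dihedral (a b r q : W) := exists p x, [/\ T p, T x, p <> x &
  [/\ generated [set p; x] a, generated [set p; x] b,
      generated [set p; x] r & generated [set p; x] q]].

Lemma in_dihedral_sym a b r q : in_dihedral a b r q -> in_dihedral r q a b.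
Proof. by move=> [p [x [Tp Tx px [? ? ? ?]]]]; exists p, x. Qed.

Lemma sat2_neq u a b : sat u [:: a; b] -> a <> b.
Proof.
move=> /sat2[Ta Tb la lb] ab; move: lb; rewrite -ab -mulgA refl_sq// mulg1; lia.
Qed.

Lemma in_dihedral_base a b r q : T a -> T b -> a <> b -> a * b = r * q ->
  r = a \/ r = b -> in_dihedral a b r q.
Proof.
move=> Ta Tb ab abrq h; exists a, b; split=> //.
have [H1 HM HV] := generated_subgroup [set a; b].
have Ha : generated [set a; b] a by apply: sub_generated; left.
have Hb : generated [set a; b] b by apply: sub_generated; right.
have qE : q = r^-1 * (a * b) by rewrite abrq mulKg.
have Hr : generated [set a; b] r by case: h => ->.
by split=> //; rewrite qE; apply: (HM); [exact: (HV)|exact: (HM)].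
Qed.

(** Induction on left descents [s] of the top, as left translation keeps labels.
   If [s] is an ascent of [u], the interval is [u], [s u], [s v], [v], and its
   labels are generated by those of one chain. If [s] is a descent of [u], either
   both chains are translated down, or one of the middle elements is [s v]; then
   the interval from [s u] to [s v] contains [u], shares three of the labels, and
   the relation between the products yields the fourth. *)
Lemma diamond_dihedral u a b r q : sat u [:: a; b] -> sat u [:: r; q] ->
  a * b = r * q -> in_dihedral a b r q.
Proof.
have [n] := ubnP (len u); elim: n u a b r q => // n IH u a b r q un sab srq abrq.
have [Ta Tb la lb] := (sat2 u a b).1 sab; have [Tr Tq lr lq] := (sat2 u r q).1 srq.
have ab := sat2_neq sab; have rq := sat2_neq srq.
have vE : u * a * b = u * r * q by rewrite -!mulgA abrq.
have v1 : u * a * b != 1 by apply/eqP => v1; move: lb; rewrite v1 len1.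
have [s Ss vs] := exists_left_descent v1.
have su : u * s ^ u = s * u by rewrite conjgE mulVKg.
have ss z : s * (s * z) = z by rewrite mulgA simple_sq// mul1g.
have [us|us] := boolP (inv u s); last first.
  have mid c d : T c -> T d -> len (u * c) = (len u).+1 -> len (u * c * d) = (len u).+2 ->
      u * c * d = u * a * b -> u * c = s * u \/ u * c = s * (u * a * b).
    move=> Tc Td lc ld cd; have [cs|cs] := boolP (inv (u * c) s).
      by left; apply: cover_simple.
    right; rewrite -cd (_ : u * c * d = s * (u * c)) ?ss//.
    by apply: cover_simple; rewrite // ?ld ?lc ?cd.
  have [ea|ea] := mid a b Ta Tb la lb erefl; have [er|er] := mid r q Tr Tq lr lq (esym vE).
  - by apply: in_dihedral_base => //; left; apply: (@mulgI _ u); rewrite er ea.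
  - apply: in_dihedral_base => //; right; apply: (@mulgI _ u).
    by rewrite er ea -!mulgA ss.
  - apply/in_dihedral_sym/in_dihedral_base => //; right; apply: (@mulgI _ u).
    by rewrite ea vE er -!mulgA ss.
  - by apply: in_dihedral_base => //; left; apply: (@mulgI _ u); rewrite er -ea.
have u0 := len_gt0_inv (simple_refl Ss) us.
have lsu : len (s * u) = (len u).-1 by rewrite len_simpleMl// us.
have low c d : sat u [:: c; d] -> u * c * d = u * a * b -> inv (u * c) s -> sat (s * u) [:: c; d].
  move=> /sat2[Tc Td lc ld] cd cs; apply/sat2; split=> //.
    by rewrite -mulgA (len_simpleMl (u * c) Ss) cs lc lsu prednK.
  rewrite -2!mulgA (mulgA u) (len_simpleMl (u * c * d) Ss) cd vs lb lsu.
  by case: (len u) u0.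
(* [v] is [s] times the middle element of the first chain, which is not lowered by [s] *)
have half c d c' d' : sat u [:: c; d] -> sat u [:: c'; d'] -> u * c * d = u * a * b ->
    u * c' * d' = u * a * b -> c * d = c' * d' -> inv (u * c') s -> ~~ inv (u * c) s ->
    in_dihedral c d c' d'.
  move=> scd scd' cd cd' e c's cs; have /sat2[Tc Td lc ld] := scd.
  have vE' : u * c * d = s * (u * c) by apply: cover_simple; rewrite // ?ld ?lc ?cd.
  have Tp : T (s ^ u) by exact/refl_conj/simple_refl.
  have sp : s * u * s ^ u = u by rewrite -mulgA su ss.
  have spc : sat (s * u) [:: s ^ u; c].
    by apply/sat2; rewrite sp lsu prednK// lc; split=> //; case: (len u) u0.
  have pc : s ^ u * c = c' * d'.
    apply: (@mulgI _ (s * u)); rewrite mulgA sp -mulgA (mulgA u) cd' -cd vE'.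
    by rewrite ss.
  have [p [x [Tp' Tx px [Hp Hc Hc' Hd']]]] := IH (s * u) (s ^ u) c c' d' ltac:(lia) spc (low _ _ scd' cd' c's) pc.
  exists p, x; split=> //; split=> //.
  have [_ HM HV] := generated_subgroup [set p; x].
  have -> : d = c^-1 * (c' * d') by rewrite -e mulKg.
  by apply: (HM); [exact: (HV)|exact: (HM)].
have [as'|as'] := boolP (inv (u * a) s); have [rs|rs] := boolP (inv (u * r) s).
- apply: (IH (s * u)) => //; [lia|exact: low|exact: low].
- by apply/in_dihedral_sym; apply: half.
- exact: half.
- have e c d : sat u [:: c; d] -> u * c * d = u * a * b -> ~~ inv (u * c) s ->
      u * c = s * (u * a * b).
    move=> /sat2[Tc Td lc ld] cd cs.
    rewrite -cd (_ : u * c * d = s * (u * c)) ?ss//.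
    by apply: cover_simple; rewrite // ?ld ?lc ?cd.
  apply: in_dihedral_base => //; left; apply: (@mulgI _ u).
  by rewrite (e a b)// (e r q).
Qed.

(** The equation between the products says that the differences of the indices of
   [a, b] and of [r, q] agree modulo the order of the rotation, which no four
   indices in the given order satisfy. *)
Lemma diamond_order lt a b r q : reflection_ordering S lt -> in_dihedral a b r q ->
  T a -> T b -> T r -> T q -> a * b = r * q -> lt q r -> lt r a -> lt a b -> False.
Proof.
move=> hlt [p [x [Tp Tx px [Ha Hb Hr Hq]]]] Ta Tb Tr Tq abrq.
have [c [d [Tc Td cd CH refls]]] := dihedral_structure Tp Tx px.
have [c' [d' [Tc' Td' sorted idx]]] : exists c' d', [/\ T c', T d', dihedral_sorted lt c' d' &
    forall h, T h -> generated [set p; x] h -> exists i, h = zalt c' d' i].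
  have [h|h] := ordering_dihedral hlt (pair_reflection_subgroup Tp Tx) cd CH.
    by exists c, d.
  exists d, c; split=> // h' Th' Hh'; have [i ->] := refls h' Th' Hh'.
  by exists (-1 - i)%Z; rewrite -zalt_sym//; exact: refl_sq.
have cc := refl_sq Tc'; have dd := refl_sq Td'.
have [m o] := ord_exists (c' * d').
have lz i j : before m i j -> lt (zalt c' d' i) (zalt c' d' j).
  exact: ((dihedral_sortedP lt cc dd o).1 sorted).
have norm h : T h -> generated [set p; x] h ->
    exists2 i, h = zalt c' d' i & m = 0%N \/ (0 <= i < Z.of_nat m)%Z.
  move=> Th Hh; have [i ->] := idx h Th Hh.
  have [m0|m0] := eqVneq m 0%N; first by exists i; [|left].
  exists (i mod Z.of_nat m)%Z; last by right; apply: Z.mod_pos_bound; lia.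
  apply/(zalt_eq cc dd _ _ o); exists (i / Z.of_nat m)%Z.
  by rewrite Zmod_eq_full; lia.
have Tz i : T (zalt c' d' i) by exact: refl_zalt.
have bef i j : (m = 0%N \/ (0 <= i < Z.of_nat m)%Z) -> (m = 0%N \/ (0 <= j < Z.of_nat m)%Z) ->
    lt (zalt c' d' i) (zalt c' d' j) -> before m i j.
  move=> di dj ij.
  have [//|[e|ji]] : before m i j \/ i = j \/ before m j i.
  - rewrite /before; case: eqP di dj => [m0 _ _|m0 di dj]; last by lia.
    have [h1|[h1|h1]] : (i < j \/ i = j \/ j < i)%Z by lia.
    + have [h|[h|h]] : (0 <= i \/ j < 0 \/ (i < 0 /\ 0 <= j))%Z by lia.
      * by left; apply: Or31; lia.
      * by left; apply: Or32; lia.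
      * by right; right; apply: Or33; lia.
    + by right; left.
    + have [h|[h|h]] : (0 <= j \/ i < 0 \/ (j < 0 /\ 0 <= i))%Z by lia.
      * by right; right; apply: Or31; lia.
      * by right; right; apply: Or32; lia.
      * by left; apply: Or33; lia.
  - by case: (lt_irr hlt (Tz j)); rewrite -{1}e.
  - by case: (lt_asym hlt (Tz i) (Tz j) ij (lz _ _ ji)).
have [ia ea da] := norm a Ta Ha; have [ib eb db] := norm b Tb Hb.
have [ir er dr] := norm r Tr Hr; have [iq eq dq] := norm q Tq Hq.
rewrite ea eb er eq in abrq *; move=> /(bef _ _ dq dr) h1 /(bef _ _ dr da) h2 /(bef _ _ da db) h3.
move: abrq; rewrite !zalt_mul// => e.
have : zexp (c' * d') (ia - ib + - (ir - iq)) = 1 by rewrite zexpD zexpN e mulgV.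
move=> /o[k kE]; move: h1 h2 h3; rewrite /before; case: eqP => m0.
  rewrite m0 Z.mul_0_r in kE.
  by case=> h1; case=> h2; case=> h3; lia.
have : (k = 0 \/ k <= -1 \/ 1 <= k)%Z by lia.
by case=> [h0|[h0|h0]] h1 h2 h3; [rewrite h0 in kE; lia|nia|nia].
Qed.
(** * The increasing chain is lexicographically first *)

Lemma exists_lt_min lt (l : seq W) : reflection_ordering S lt -> {in l, forall t, T t} ->
  l != [::] -> exists2 m, m \in l & {in l, forall t, t = m \/ lt m t}.
Proof.
move=> hlt; elim: l => // a l IH Tl _.
have Ta : T a by apply: Tl; exact: mem_head.
have Tl' : {in l, forall t, T t} by move=> t tl; apply: Tl; rewrite inE tl orbT.
have [l0|/(IH Tl')[m ml mP]] := eqVneq l [::].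
  by exists a; rewrite ?mem_head// l0 => t; rewrite inE => /eqP; left.
have Tm := Tl' m ml; have [am|nam] := pselect (lt a m).
  exists a; first exact: mem_head.
  move=> t; rewrite inE => /orP[/eqP|tl]; first by left.
  right; have [->//|mt] := mP t tl; exact: (lt_tr hlt Ta Tm (Tl' t tl)).
exists m; first by rewrite inE ml orbT.
move=> t; rewrite inE => /orP[/eqP->|/mP//].
by have [//||] := lt_total hlt Ta Tm; [left|right].
Qed.

(** Let [m] be the smallest atom label. If the increasing chain from [u * m] to [v]
   is empty or starts above [m], it extends to an increasing chain from [u], and
   uniqueness applies. Otherwise the first two steps form a descending chain of
   an interval of length two, whose increasing chain starts below [m]. *)
Lemma first_label_min lt u t l v r : reflection_ordering S lt ->
  inc_chain lt u (t :: l) v -> T r -> len (u * r) = (len u).+1 -> u * r <=b v ->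
  r = t \/ lt t r.
Proof.
move=> hlt hl Tr lr rv; have [k _ kP] := lower_finite v.
pose atoms := [seq a <- [seq u^-1 * y | y <- k] | `[< T a >] && (len (u * a) == (len u).+1)].
have atomsP a : a \in atoms <-> [/\ T a, len (u * a) = (len u).+1 & u * a <=b v].
  rewrite mem_filter; split.
    move=> /andP[/andP[/asboolP Ta /eqP la] /mapP[y /kP yv ay]].
    by split=> //; rewrite ay mulVKg.
  move=> [Ta la /kP av]; rewrite la eqxx andbT; apply/andP; split; first exact/asboolP.
  by apply/mapP; exists (u * a) => //; rewrite mulKg.
have ratom : r \in atoms by apply/atomsP.
have [||m matom mmin] := @exists_lt_min lt atoms hlt.
- by move=> a /atomsP[].
- by case: (atoms) ratom.
suff -> : t = m by exact: mmin.
have [Tm lm mv] := (atomsP m).1 matom.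
have [w [hw wU]] := inc_chain_unique hlt (inc_chain_le hl).
have same k' : inc_chain lt u (m :: k') v -> t = m.
  by move=> /wU e; have := wU _ hl; rewrite e => -[].
have [k' [hk' _]] := inc_chain_unique hlt mv.
case: k' hk' => [|m2 k'] hk'.
  apply: (same [::]); have [_ _] := hk'; rewrite endpt_nil => <-.
  split=> //; last by rewrite endpt_cons endpt_nil.
  by apply/sat_cons; split=> //; exact: sat_nil.
have [/sat_cons[T2 l2 s2] [i2 ik'] ev] := hk'.
have mm2 : m <> m2 by move=> e; move: l2; rewrite -e -mulgA refl_sq// mulg1; lia.
have [h|nh] := pselect (lt m m2).
  apply: (same (m2 :: k')); split=> //; last by rewrite endpt_cons.
    by apply/sat_cons; split=> //; apply/sat_cons.
  split=> // a; rewrite inE => /orP[/eqP->//|ak].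
  exact: (lt_tr hlt Tm T2 (sat_refl s2 ak) h (i2 _ ak)).
have m2m : lt m2 m by exact: (lt_nlt hlt).
have sm : sat u [:: m; m2] by apply/sat2; split=> //; rewrite l2 lm.
have um : u <=b u * m * m2 by have := sat_le sm; rewrite !endpt_cons endpt_nil.
have [p [[sp ip ep] _]] := inc_chain_unique hlt um.
have := sp.2; rewrite ep l2 lm.
case: p sp ip ep => [|a [|b [|c p]]] sp ip ep /=; try lia.
move=> _; rewrite !endpt_cons endpt_nil in ep.
have [Ta Tb la lb] := (sat2 u a b).1 sp.
have ab : lt a b by apply: ip.1; exact: mem_head.
have abm : a * b = m * m2 by apply: (@mulgI _ u); rewrite !mulgA.
have aatom : a \in atoms.
  apply/atomsP; split=> //; apply: (@bruhat_trans (u * m * m2)); last first.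
    by rewrite -ev endpt_cons; exact: sat_le.
  rewrite -ep; apply: bruhat_up => //; rewrite -len_up// lb la; exact: ltnSn.
case: (mmin a aatom) => [am|ma].
  have bm2 : b = m2 by move: abm; rewrite am => /mulgI.
  by case: nh; rewrite -am -bm2.
case: (diamond_order hlt (diamond_dihedral sp sm abm) Ta Tb Tm T2 abm m2m ma ab).
Qed.

Lemma inc_chain_lex lt u l v l' : reflection_ordering S lt -> inc_chain lt u l v ->
  sat u l' -> endpt u l' = v -> l' <> l -> lex_lt lt l l'.
Proof.
move=> hlt; elim: l u l' => [|t l IH] u l' hl sl' el'.
  have := inc_chain_len hl; rewrite -el' sl'.2 /=; case: l' {sl' el'} => // a l' /=; lia.
case: l' sl' el' => [|t' l'] sl' el' ne.
  by have := inc_chain_len hl; rewrite -el' sl'.2 /=; lia.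
have /sat_cons[Tt' lt' sl] := sl'; rewrite endpt_cons in el'.
have [//|e|tt'] := first_label_min hlt hl Tt' lt'.
- by rewrite -el'; exact: sat_le.
- right; split=> //; rewrite e in sl el' ne; apply: (IH (u * t)) => //.
    have [/sat_cons[_ _ s1] [_ i1] e1] := hl; split=> //.
    by rewrite endpt_cons in e1.
  by move=> el; apply: ne; rewrite el.
- by left.
Qed.

(** * Translates of lower intervals *)

Lemma lower_dn v w s : S s -> dn w s -> v <=b w -> pair_min s v <=b w * s.
Proof. by move=> Ss ws vw; have [+ _] := bruhat_lift Ss vw; rewrite {2}/pair_min ws. Qed.

(** With [w = w' s], every element below [w] is [v] or [v * s] for some [v] below
   [w']. Whether [s] is an inversion of [y] decides which of [v * y] and
   [v * s * y] is smaller, so the bounds for [w] and [y] are bounds for [w'] with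
   [y] or [s * y]. *)
Lemma translate_bounds w y : exists vb vt, [/\ vb <=b w, vt <=b w &
  forall v, v <=b w -> vb * y <=b v * y /\ v * y <=b vt * y].
Proof.
have [n] := ubnP (len w); elim: n w y => // n IH w y wn.
have [->|/exists_descent[s Ss ws]] := eqVneq w 1.
  exists 1, 1; split; [exact: bruhat_refl|exact: bruhat_refl|].
  move=> v v1; have -> : v = 1.
    by apply: len0; have [+ _] := bruhat_len v1; rewrite len1 leqn0 => /eqP.
  by split; exact: bruhat_refl.
have Ts := simple_refl Ss.
have w0 := len_gt0_dn Ss ws.
have wsw : w * s <=b w by exact: bruhat_dn.
have ltn : (len (w * s) < n)%N by rewrite len_simpleMr// ws; lia.
have [b1 [t1 [b1w t1w P1]]] := IH (w * s) y ltn.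
have [b2 [t2 [b2w t2w P2]]] := IH (w * s) (s * y) ltn.
have le v : v <=b w * s -> v <=b w by move=> h; exact: bruhat_trans wsw.
have les v : v <=b w * s -> v * s <=b w by move=> /le h; exact: lift_up.
have down v : v <=b w -> dn v s -> v * s <=b w * s.
  by move=> /(lower_dn Ss ws); rewrite /pair_min => + d; rewrite d.
have stay v : v <=b w -> ~~ dn v s -> v <=b w * s.
  by move=> /(lower_dn Ss ws); rewrite /pair_min => + /negPf d; rewrite d.
have e v : v * (s * y) = v * y * s ^ y by rewrite conjgE !mulgA mulgK.
have e' v : v * s * (s * y) = v * y by rewrite mulgA mulss.
have Tsy : T (s ^ y) by exact: refl_conj.
have [ys|ys] := boolP (inv y s).
  have sw v : ~~ dn v s -> v * (s * y) <=b v * y.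
    by move=> vs; rewrite e; apply: bruhat_dn => //; rewrite dnMr (negPf vs) ys.
  exists (b2 * s), t1; split=> [||v vw]; [exact: les|exact: le|].
  rewrite -mulgA; have [vs|vs] := boolP (dn v s); last first.
    have vw' := stay v vw vs; split; last exact: (P1 v vw').2.
    exact: bruhat_trans (P2 v vw').1 (sw v vs).
  have vw' := down v vw vs; rewrite -(e' v); split; first exact: (P2 _ vw').1.
  apply: bruhat_trans (P1 _ vw').2; apply: sw; rewrite dn_simple// vs //.
have sw v : ~~ dn v s -> v * y <=b v * (s * y).
  by move=> vs; rewrite e; apply: bruhat_up => //; rewrite dnMr (negPf vs) (negPf ys).
exists b1, (t2 * s); split=> [||v vw]; [exact: le|exact: les|].
rewrite -(mulgA t2); have [vs|vs] := boolP (dn v s); last first.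
  have vw' := stay v vw vs; split; first exact: (P1 v vw').1.
  exact: bruhat_trans (sw v vs) (P2 v vw').2.
have vw' := down v vw vs; rewrite -(e' v); split; last exact: (P2 _ vw').2.
by apply: bruhat_trans (P1 _ vw').1 _; apply: sw; rewrite dn_simple// vs.
Qed.

Section TwistedInterval.
Variables (lt : W -> W -> Prop) (w x : W).
Hypotheses (hlt : reflection_ordering S lt)
  (hx : initial_section T lt (left_inversions S x)).

Local Notation P := (twisted_lower_interval S w x).

Lemma twistedP y : P y <-> y * x <=b w.
Proof.
split=> [[v vw <-]|yw]; first by rewrite mulgVK.
by exists (y * x) => //; rewrite mulgK.
Qed.

Lemma inversions_initial t t' : T t -> T t' -> lt t t' -> inv x t' -> inv x t.
Proof.
move=> Tt Tt' tt' /asboolP xt'; apply/asboolP.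
case: hx xt' => [->//|->//|[a Ta ->] [_ ta]].
by split=> //; exact: (lt_tr hlt Tt Tt').
Qed.

Lemma twisted_step c t : c * t * x = c * x * t ^ x.
Proof. by rewrite conjgE !mulgA mulgK. Qed.

Lemma up_path_twisted c l : up_path c l -> {in l, forall t, ~~ inv x t} ->
  c * x <=b endpt c l * x.
Proof.
elim: l c => [|t l IH] c /=; first by rewrite endpt_nil => *; exact: bruhat_refl.
move=> [Tt ct cl] nx; rewrite endpt_cons.
apply: (@bruhat_trans (c * t * x)); last first.
  by apply: IH => // r rl; apply: nx; rewrite inE rl orbT.
rewrite twisted_step; apply: bruhat_up; first exact: refl_conj.
by rewrite dnMr (negPf ct) (negPf (nx t (mem_head _ _))).
Qed.

(** The starting point is left out, as in [maximal_chain]. *)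
Fixpoint vertices (c : W) (l : seq W) : seq W :=
  if l is t :: l' then c * t :: vertices (c * t) l' else [::].

(** While the labels are inversions of [x], the elements [y * x] descend from
   [c * x]; from the first other label on, they ascend to [q * x]. *)
Lemma inc_chain_stays c l q : inc_chain lt c l q -> P c -> P q ->
  {in vertices c l, forall y, P y}.
Proof.
elim: l c => [|t l IH] c //= hl Pc Pq.
have [[[Tt ct cl] _] [it il] eq] := hl.
suff Pct : P (c * t).
  move=> y; rewrite inE => /orP[/eqP->//|]; apply: IH => //.
  have [/sat_cons[_ _ s1] _ e1] := hl; split=> //.
  by rewrite endpt_cons in e1.
apply/twistedP; have [xt|xt] := boolP (inv x t).
  apply: bruhat_trans ((twistedP c).1 Pc); rewrite twisted_step.
  by apply: bruhat_dn; [exact: refl_conj|rewrite dnMr (negPf ct) xt].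
apply: bruhat_trans ((twistedP q).1 Pq); rewrite -eq endpt_cons.
apply: up_path_twisted => // r rl; apply: contra xt; apply: inversions_initial => //.
  exact: up_path_refl cl _ rl.
exact: it.
Qed.

Lemma covers_step c t : P c -> P (c * t) -> T t -> len (c * t) = (len c).+1 ->
  covers P (bruhat S) c (c * t).
Proof.
move=> Pc Pct Tt ct; split=> //.
- by apply: bruhat_up => //; rewrite -len_up// ct.
- by move=> e; move: ct; rewrite -e; lia.
move=> u Pu /bruhat_len[h1 h2] /bruhat_len[h3 h4].
have [h|h] : len c = len u \/ len u = len (c * t) by lia.
  by left; rewrite h2.
by right; exact: h4.
Qed.

Lemma covers_label y z : covers P (bruhat S) y z -> T (y^-1 * z) /\ len z = (len y).+1.
Proof.
move=> [Py Pz yz ne h]; have [l [hl _]] := inc_chain_unique hlt yz.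
have := inc_chain_stays hl Py Pz; case: l hl => [|t l] hl.
  by have [_ _] := hl; rewrite endpt_nil => /ne.
move=> /(_ (y * t)) /= /(_ (mem_head _ _)) Pyt.
have [/sat_cons[Tt lt' sl] _ ez] := hl; rewrite endpt_cons in ez.
have tz : y * t <=b z by rewrite -ez; exact: sat_le.
have yt : y <=b y * t by apply: bruhat_up => //; rewrite -len_up// lt'.
have [e|<-] := h _ Pyt yt tz; first by move: lt'; rewrite e; lia.
by rewrite mulKg.
Qed.

Lemma vertices_labels c l : pairmap (@right_label W) c (vertices c l) = l.
Proof. by elim: l c => [|t l IH] c //=; rewrite IH /right_label mulKg. Qed.

Lemma last_vertices c l : last c (vertices c l) = endpt c l.
Proof. by elim: l c => [|t l IH] c /=; rewrite ?endpt_nil// IH endpt_cons. Qed.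

Lemma labels_vertices c k : vertices c (pairmap (@right_label W) c k) = k.
Proof. by elim: k c => [|y k IH] c //=; rewrite /right_label mulVKg IH. Qed.

Lemma maximal_chain_vertices c l q : P c -> sat c l -> endpt c l = q ->
  {in vertices c l, forall y, P y} -> maximal_chain P (bruhat S) c (vertices c l) q.
Proof.
move=> Pc sl el Pl; split; last by rewrite last_vertices.
elim: l c Pc sl {el} Pl => [|t l IH] c //= Pc /sat_cons[Tt ct sl] Pl.
have Pct : P (c * t) by apply: Pl; exact: mem_head.
apply/andP; split; first by apply/asboolP; exact: covers_step.
by apply: IH => // y yl; apply: Pl; rewrite inE yl orbT.
Qed.

Lemma maximal_chain_sat c k q : maximal_chain P (bruhat S) c k q ->
  sat c (pairmap (@right_label W) c k) /\ endpt c (pairmap (@right_label W) c k) = q.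
Proof.
move=> [+ <-]; elim: k c => [|y k IH] c /=.
  by rewrite endpt_nil => _; split=> //; exact: sat_nil.
move=> /andP[/asboolP/covers_label[Tl ly] /IH[s1 e1]].
rewrite endpt_cons /right_label mulVKg; split=> //.
by apply/sat_cons; rewrite mulVKg.
Qed.

Lemma inc_increasing l : {in l, forall t, T t} -> inc lt l <-> increasing lt l.
Proof.
rewrite /increasing; elim: l => [|t [|r l] IH] Tl //=.
have Tl' : {in r :: l, forall t, T t} by move=> a al; apply: Tl; rewrite inE al orbT.
split.
  move=> [it /(IH Tl') irl]; apply/andP; split=> //.
  by apply/asboolP; apply: it; exact: mem_head.
move=> /andP[/asboolP tr /(IH Tl') irl]; split=> // a; rewrite inE => /orP[/eqP->//|al].
apply: (lt_tr hlt _ _ _ tr (irl.1 _ al)); first exact/Tl/mem_head.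
  by apply: Tl'; exact: mem_head.
by apply: Tl'; rewrite inE al orbT.
Qed.

Theorem twisted_EL : EL_labeling P (bruhat S) T lt (@right_label W).
Proof.
split.
- split.
  + have [l _ lP] := lower_finite w; apply: finite_image.
    by apply: (sub_finite_set _ (finite_seq l)) => v /lP.
  + split=> [y _|y z _ _|y z u _ _ _]; [exact: bruhat_refl|exact: bruhat_anti|exact: bruhat_trans].
  + have [vb [vt [hb ht h]]] := translate_bounds w x^-1.
    exists (vb * x^-1), (vt * x^-1); split; [by exists vb|by exists vt| |].
      by move=> _ [v vw <-]; exact: h.
    move=> c c' /maximal_chain_sat[[_ s1] e1] /maximal_chain_sat[[_ s2] e2].
    by move: s1 s2; rewrite e1 e2 !size_pairmap => ->; lia.
- by case: hlt.
- by move=> y z /covers_label[].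
move=> p q Pp Pq pq; have [l [hl lU]] := inc_chain_unique hlt pq.
have [sl il el] := hl; have stays := inc_chain_stays hl Pp Pq.
exists (vertices p l); split.
- exact: maximal_chain_vertices.
- by rewrite vertices_labels; apply/inc_increasing => //; exact: sat_refl sl.
- move=> c' /maximal_chain_sat[s' e'] /inc_increasing i'.
  rewrite -(labels_vertices p c'); congr vertices; apply/esym/lU; split=> //.
  by apply: i'; exact: sat_refl s'.
- move=> c' /maximal_chain_sat[s' e'] ne; rewrite vertices_labels.
  apply: inc_chain_lex hl s' e' _ => // e; apply: ne.
  by rewrite -(labels_vertices p c') e.
Qed.

End TwistedInterval.
End Coxeter.

Theorem theorem5p5 (W : groupType) (S : set W) (hS : coxeter_system S)
    (w x : W) (lt : W -> W -> Prop)
    (hlt : reflection_ordering S lt)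
    (hx : initial_section (reflections S) lt (left_inversions S x)) :
  EL_labeling (twisted_lower_interval S w x) (bruhat S)
    (reflections S) lt (@right_label W).
Proof. exact: (twisted_EL hS). Qed.
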